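(* Let $K$ be a field and $n\ge 1$. For $a=(a_0,\dots,a_{n-1})\in K^n$ let $p_a(x)=x^n+a_{n-1}x^{n-1}+\dots+a_1x+a_0\in K[x]$. Let $U$ be the set of $a\in K^n$ such that $p_a$ is separable and irreducible in $K[x]$, and for $a,b\in U$ write $a\approx b$ if $K[x]/(p_a)$ and $K[x]/(p_b)$ are isomorphic as $K$-algebras. Let $a\in U$ and let $D$ be the $\approx$-class of $a$. Then there is an EE subset $X$ of $K^n$ with $a\in X\subseteq D$.
   Context: A $K$-variety is a separated reduced $K$-scheme of finite type. If $W$ is a $K$-variety, a subset $X\subseteq W(K)$ is an EE subset (existentially étale set) if there exist a $K$-variety $V$ and an étale morphism $f:V\to W$ with $X=f(V(K))$. Here $K^n=\mathbb{A}^n(K)$. *)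

(* Defs.v *)
(* Schemes over a field K are given by their functors of points, following
   Demazure and Gabriel (Groupes algebriques, chap. I, par. 1): a K-scheme is a
   functor from commutative K-algebras to sets which is a sheaf for the Zariski
   topology and has a covering by affine open subfunctors. *)
From HB Require Import structures.
From mathcomp Require Import all_boot all_order all_algebra all_field.
Set Implicit Arguments.
Unset Strict Implicit.
Unset Printing Implicit Defensive.
Import GRing.Theory.
Local Open Scope ring_scope.

(* comAlgType excludes the zero ring, which is needed here both as a test
   algebra and as the ring of functions on the empty scheme. *)
Record kalg (K : fieldType) := KAlg {
  kalg_ring :> comPzRingType;
  kalg_str : {rmorphism K -> kalg_ring}
}.

Record khom (K : fieldType) (A B : kalg K) := KHom {
  khom_fun :> {rmorphism A -> B};
  khom_str : forall c : K, khom_fun (kalg_str A c) = kalg_str B c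
}.

Definition kbase (K : fieldType) : kalg K := @KAlg K K idfun.

Definition kinit (K : fieldType) (A : kalg K) : khom (kbase K) A :=
  @KHom K (kbase K) A (kalg_str A) (fun c => erefl (kalg_str A c)).

Section Algebras.
Variable K : fieldType.
Implicit Types A B C P : kalg K.

Definition is_field A :=
  1 <> 0 :> A /\ forall x : A, x <> 0 -> exists y : A, x * y = 1.

Definition is_reduced A := forall (x : A) (k : nat), x ^+ k = 0 -> x = 0.

(* h identifies B with the localization A[1/f]. *)
Definition is_localization A B (h : khom A B) (f : A) :=
  [/\ exists g : B, h f * g = 1,
      forall b : B, exists (a : A) (k : nat), b * h f ^+ k = h a
    & forall a : A, h a = 0 -> exists k : nat, f ^+ k * a = 0].

Definition surjective_hom A B (h : khom A B) :=
  forall b : B, exists a : A, h a = b.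

Definition in_ideal A (m : nat) (r : 'I_m -> A) (x : A) :=
  exists c : 'I_m -> A, x = \sum_(i < m) c i * r i.

(* i identifies P with the polynomial ring over A in the variables X, by its
   universal property. *)
Definition is_polynomial_ring A P (i : khom A P) (m : nat) (X : 'I_m -> P) :=
  forall C (g : khom A C) (y : 'I_m -> C),
    (exists h : khom P C,
       (forall a, h (i a) = g a) /\ (forall j, h (X j) = y j)) /\
    (forall h h' : khom P C,
       (forall a, h (i a) = g a) -> (forall j, h (X j) = y j) ->
       (forall a, h' (i a) = g a) -> (forall j, h' (X j) = y j) -> h =1 h').

Definition finite_type_hom A B (phi : khom A B) :=
  exists (m : nat) P (i : khom A P) (X : 'I_m -> P) (q : khom P B),
    [/\ is_polynomial_ring i X, forall a, q (i a) = phi a & surjective_hom q].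

Definition finite_presentation_hom A B (phi : khom A B) :=
  exists (m : nat) P (i : khom A P) (X : 'I_m -> P) (q : khom P B),
    [/\ is_polynomial_ring i X, forall a, q (i a) = phi a, surjective_hom q
      & exists (l : nat) (r : 'I_l -> P),
          forall p : P, q p = 0 <-> in_ideal r p].

End Algebras.

(* The functor laws are stated up to pointwise equality of homomorphisms, so
   that fmap depends only on the underlying function. *)
Record kfunctor (K : fieldType) := KFunctor {
  pts :> kalg K -> Type;
  fmap : forall A B : kalg K, khom A B -> pts A -> pts B;
  fmap_id : forall (A : kalg K) (h : khom A A),
    (forall a, h a = a) -> forall x, fmap h x = x;
  fmap_comp : forall (A B C : kalg K)
      (g : khom B C) (h : khom A B) (k : khom A C),
    (forall a, k a = g (h a)) -> forall x, fmap k x = fmap g (fmap h x)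
}.

Record kmor (K : fieldType) (F G : kfunctor K) := KMor {
  mapp :> forall A : kalg K, F A -> G A;
  mapp_nat : forall (A B : kalg K) (h : khom A B) (x : F A),
    mapp (fmap h x) = fmap h (mapp x)
}.

Section Schemes.
Variable K : fieldType.
Implicit Types (A B C L : kalg K) (F V W : kfunctor K).

(* For f_i generating the unit ideal of A, with B_i = A[1/f_i] and
   B_ij = A[1/(f_i f_j)], the sequence F(A) -> prod F(B_i) => prod F(B_ij) is
   an equalizer. *)
Definition zariski_sheaf F :=
  forall A (m : nat) (f : 'I_m -> A)
         (B : 'I_m -> kalg K) (h : forall i, khom A (B i))
         (B2 : 'I_m -> 'I_m -> kalg K) (h2 : forall i j, khom A (B2 i j))
         (l : forall i j, khom (B i) (B2 i j))
         (r : forall i j, khom (B j) (B2 i j)),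
    in_ideal f 1 ->
    (forall i, is_localization (h i) (f i)) ->
    (forall i j, is_localization (h2 i j) (f i * f j)) ->
    (forall i j a, l i j (h i a) = h2 i j a) ->
    (forall i j a, r i j (h j a) = h2 i j a) ->
    forall x : forall i, F (B i),
      (forall i j, fmap (l i j) (x i) = fmap (r i j) (x j)) ->
      exists! y : F A, forall i, fmap (h i) y = x i.

(* The pull-back of U along each x : Spec A -> F is the open subscheme of
   Spec A whose complement is the zero locus of some S. *)
Definition open_subfunctor F (U : forall A, F A -> Prop) :=
  forall A (x : F A), exists S : A -> Prop,
    forall B (h : khom A B),
      U B (fmap h x) <->
      exists (m : nat) (s : 'I_m -> A),
        (forall i, S (s i)) /\ in_ideal (fun i => h (s i)) 1.

(* By Yoneda u is a morphism Spec A -> F; this says that it is an open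
   immersion. *)
Definition affine_open F A (u : F A) :=
  (forall B (h h' : khom A B), fmap h u = fmap h' u -> h =1 h') /\
  open_subfunctor (fun B (y : F B) => exists h : khom A B, fmap h u = y).

(* Open subfunctors cover F when they do so on points in every field. *)
Definition affine_open_cover F (I : Type) (A : I -> kalg K)
    (u : forall i, F (A i)) :=
  (forall i, affine_open (u i)) /\
  (forall L, is_field L -> forall x : F L,
     exists (i : I) (h : khom (A i) L), fmap h (u i) = x).

Definition is_scheme F :=
  zariski_sheaf F /\
  exists (I : Type) (A : I -> kalg K) (u : forall i, F (A i)),
    affine_open_cover u.

Definition finite_type F :=
  exists (m : nat) (A : 'I_m -> kalg K) (u : forall i, F (A i)),
    affine_open_cover u /\ forall i, finite_type_hom (kinit (A i)).

Definition reduced F := forall A (u : F A), affine_open u -> is_reduced A.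

(* The diagonal of F is a closed immersion: the locus in Spec A where two
   A-points agree is the zero locus of some S. *)
Definition separated F :=
  forall A (x y : F A), exists S : A -> Prop,
    forall B (h : khom A B),
      fmap h x = fmap h y <-> forall s, S s -> h s = 0.

Definition is_variety F :=
  [/\ is_scheme F, separated F, reduced F & finite_type F].

Definition formally_etale V W (f : kmor V W) :=
  forall A B (h : khom A B),
    surjective_hom h -> (forall a b : A, h a = 0 -> h b = 0 -> a * b = 0) ->
    forall (x : V B) (w : W A), fmap h w = f B x ->
      exists! v : V A, fmap h v = x /\ f A v = w.

(* Every point of V has an affine open neighbourhood Spec A mapped by f into an
   affine open Spec B of W, with A finitely presented over B. *)
Definition locally_of_finite_presentation V W (f : kmor V W) :=
  forall L, is_field L -> forall x : V L,
    exists A (u : V A) B (w : W B) (phi : khom B A),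
      [/\ affine_open u, exists h : khom A L, fmap h u = x, affine_open w,
          f A u = fmap phi w & finite_presentation_hom phi].

Definition etale V W (f : kmor V W) :=
  locally_of_finite_presentation f /\ formally_etale f.

Definition EE_subset W (X : W (kbase K) -> Prop) :=
  exists (V : kfunctor K) (f : kmor V W),
    [/\ is_variety V, etale f
      & forall w, X w <-> exists v : V (kbase K), f (kbase K) v = w].

End Schemes.

Section AffineSpace.
Variables (K : fieldType) (n : nat).

Fact affine_fmap_id (A : kalg K) (h : khom A A) :
  (forall a, h a = a) -> forall x : 'rV[A]_n, map_mx h x = x.
Proof. by move=> hE x; apply/matrixP=> i j; rewrite mxE hE. Qed.

Fact affine_fmap_comp (A B C : kalg K)
    (g : khom B C) (h : khom A B) (k : khom A C) :
  (forall a, k a = g (h a)) ->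
  forall x : 'rV[A]_n, map_mx k x = map_mx g (map_mx h x).
Proof. by move=> kE x; apply/matrixP=> i j; rewrite !mxE kE. Qed.

Definition affine_space : kfunctor K :=
  @KFunctor K (fun A => 'rV[A]_n) (fun A B h x => map_mx h x)
    affine_fmap_id affine_fmap_comp.

Definition p_ (a : 'rV[K]_n) : {poly K} :=
  'X^n + \sum_(i < n) a 0 i *: 'X^i.

Definition U (a : 'rV[K]_n) := separable_poly (p_ a) /\ irreducible_poly (p_ a).

(* For n >= 1 the polynomial p_ a is monic of positive degree, in which case
   {poly %/ p_ a} is K[x]/(p_a). *)
Definition approx (a b : 'rV[K]_n) :=
  exists f : {lrmorphism {poly %/ p_ a} -> {poly %/ p_ b}}, bijective f.

End AffineSpace.

(* Main.v *)
From HB Require Import structures.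
Require Import Defs.
From mathcomp Require Import all_boot all_order all_algebra all_field.
From mathcomp Require Import generic_quotient mpoly.
From Stdlib Require Import ClassicalEpsilon.
Set Implicit Arguments.
Unset Strict Implicit.
Unset Printing Implicit Defensive.
Import GRing.Theory.
Local Open Scope ring_scope.
Local Open Scope quotient_scope.

                                                

(** Write p_b for the monic polynomial of degree n with lower coefficients b, over any K-algebra.
    The set X consists of the b such that p_b is the relation satisfied by some generator of L =
    K[x]/(p_a). An element r of L is a row of n coordinates, and it generates L exactly when 1, r,
    ..., r^(n-1) form a basis, that is, when a determinant polynomial in the coordinates is
    invertible. Generators are thus the points of a principal open subscheme V of affine n-space
    ([gen_functor]), and sending a generator to the coefficients of its monic relation of degree n
    is a morphism from V to affine n-space ([gen_map]). A K-point of V with relation p_b identifies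
    K[x]/(p_b) with L, so b lies in the class of a ([rational_point_approx]); the generator x yields
    a itself ([base_point]).

    It remains to see that V is a variety, which follows from its being represented by a localized
    polynomial ring ([gen_variety]), and that the map is etale. Finite presentation comes from
    explicit equations ([gen_finite_presentation]). For formal etaleness, let A -> B be surjective
    with square-zero kernel, let r generate B[x]/(p_a) with relation b, and let b be lifted to A; a
    unique generator over A must lift r with the lifted relation. The trick is to exchange the roles
    of a and b. Through r, the algebra B[x]/(p_a) becomes B[x]/(p_b), and x becomes a root of p_a
    there. As p_a is separable with coefficients in K, a Newton step lifts this root to A[x]/(p_b),
    uniquely ([mx_root_lift], [mx_root_uniq]). The lifted root still generates, because units lift;
    exchanging the roles back gives the lift of r ([generator_lift], [generator_uniq]).

    Concretely, A[x]/(p_b) is realized as the commutant of the companion matrix of b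
    ([commute_companion_row_eval]), and the exchange of roles is conjugation by the matrix of powers
    of the generator ([companion_conj], [dual_krylov], [dual_root]). *)

(** * Commutative algebra over K: homomorphisms, quotients, localizations, polynomial rings *)

(** Test algebras may be zero, while polynomial rings are formed over nonzero rings; this case split
    bridges the two. *)
Lemma comPzRing_zero_or_nz (R : comPzRingType) :
  1 = 0 :> R \/ exists R' : comNzRingType, R = R' :> comPzRingType.
Proof.
have [/eqP|nz] := boolP (1 == 0 :> R); [by left | right].
pose m := GRing.PzSemiRing_isNonZero.Build R nz.
pose R' : comNzRingType := HB.pack R m.
by exists R'; rewrite /R'; case: R nz @m @R'.
Qed.

Lemma zero_ring_eq (R : pzRingType) (x y : R) : 1 = 0 :> R -> x = y.
Proof. by move=> z; rewrite -[x]mulr1 -[y]mulr1 z !mulr0. Qed.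

Section Homs.
Variable K : fieldType.
Implicit Types A B C : kalg K.

Lemma khom_of_fun A B (f : A -> B) :
    (forall x y, f (x - y) = f x - f y) -> f 1 = 1 ->
    (forall x y, f (x * y) = f x * f y) ->
    (forall c, f (kalg_str A c) = kalg_str B c) ->
  exists h : khom A B, h =1 f.
Proof.
move=> fB f1 fM fs.
pose m1 := GRing.isZmodMorphism.Build A B f fB.
pose m2 := GRing.isMonoidMorphism.Build A B f (conj f1 fM).
pose F : {rmorphism A -> B} := HB.pack f m1 m2.
by exists (@KHom K A B F fs).
Qed.

(** Serves for maps defined through a choice of representatives, such as maps out of a ring of
    fractions: being functional, the relation makes the chosen values respect the operations. *)
Lemma khom_of_graph A B (G : A -> B -> Prop) :
    (forall x, exists y, G x y) ->
    (forall x y y', G x y -> G x y' -> y = y') ->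
    (forall x x' y y', G x y -> G x' y' -> G (x - x') (y - y')) ->
    (forall x x' y y', G x y -> G x' y' -> G (x * x') (y * y')) ->
    (forall c, G (kalg_str A c) (kalg_str B c)) ->
  exists h : khom A B, forall x, G x (h x).
Proof.
move=> Gtot Gfun GB GM Gs.
pose f x := proj1_sig (constructive_indefinite_description _ (Gtot x)).
have Gf x : G x (f x) by rewrite /f; case: constructive_indefinite_description.
have [|||c|h hE] := @khom_of_fun A B f.
- by move=> x y; apply: Gfun (Gf _) _; apply: GB.
- by apply: Gfun (Gf _) _; have := Gs 1; rewrite !rmorph1.
- by move=> x y; apply: Gfun (Gf _) _; apply: GM.
- exact: Gfun (Gf _) _.
by exists h => x; rewrite hE.
Qed.

Lemma khom_comp A B C (g : khom B C) (h : khom A B) :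
  exists k : khom A C, forall a, k a = g (h a).
Proof.
by apply: (@khom_of_fun A C (fun a => g (h a))) => *;
  rewrite ?rmorphB ?rmorph1 ?rmorphM ?khom_str.
Qed.

Lemma khom_id A : exists k : khom A A, forall a, k a = a.
Proof. exact: (@khom_of_fun A A id). Qed.

End Homs.

Section Quotient.
Variable R : comPzRingType.

Record ideal_of := IdealOf {
  ideal_pred :> R -> Prop;
  ideal0 : ideal_pred 0;
  idealD : forall x y, ideal_pred x -> ideal_pred y -> ideal_pred (x + y);
  idealM : forall x y, ideal_pred y -> ideal_pred (x * y)
}.

Variable J : ideal_of.

Lemma idealN x : J x -> J (- x).
Proof. by rewrite -mulN1r; apply: idealM. Qed.

(** Ideals are arbitrary predicates, so excluded middle supplies the boolean relation that the
    quotient construction takes. *)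
Definition iequiv (x y : R) : bool := excluded_middle_informative (J (x - y)).

Lemma iequivP x y : reflect (J (x - y)) (iequiv x y).
Proof. by apply: (iffP idP); rewrite /iequiv; case: excluded_middle_informative. Qed.

Lemma iequiv_is_equiv : equiv_class_of iequiv.
Proof.
split=> [x|x y|y x z].
- by apply/iequivP; rewrite subrr; apply: ideal0.
- by apply/iequivP/iequivP => /idealN; rewrite opprB.
move=> /iequivP xy /iequivP yz; apply/iequivP.
by rewrite -[x](addrNK y) -addrA; apply: idealD.
Qed.

Canonical iequiv_equiv := EquivRelPack iequiv_is_equiv.
Canonical iequiv_encModRel := defaultEncModRel iequiv.

Definition iquot := {eq_quot iequiv}.
HB.instance Definition _ : EqQuotient R iequiv iquot := EqQuotient.on iquot.
HB.instance Definition _ := Choice.on iquot.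

Lemma iquot_eqP x y : reflect (J (x - y)) (x == y %[mod iquot]).
Proof. by rewrite piE; apply: iequivP. Qed.

Lemma repr_iquot x : J (x - repr (\pi_iquot x)).
Proof. by apply/iquot_eqP; rewrite reprK. Qed.

Definition iq0 : iquot := lift_cst iquot 0.
Definition iq1 : iquot := lift_cst iquot 1.
Definition iqadd := lift_op2 iquot +%R.
Definition iqmul := lift_op2 iquot *%R.
Definition iqopp := lift_op1 iquot -%R.
Canonical pi_iq0_morph := PiConst iq0.
Canonical pi_iq1_morph := PiConst iq1.

Lemma pi_iqopp : {morph \pi : x / - x >-> iqopp x}.
Proof.
move=> x; unlock iqopp; apply/eqP/iquot_eqP; rewrite -opprD.
exact/idealN/repr_iquot.
Qed.
Canonical pi_iqopp_morph := PiMorph1 pi_iqopp.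

Lemma pi_iqadd : {morph \pi : x y / x + y >-> iqadd x y}.
Proof.
move=> x y; unlock iqadd; apply/eqP/iquot_eqP.
by rewrite opprD addrACA; apply: idealD; apply: repr_iquot.
Qed.
Canonical pi_iqadd_morph := PiMorph2 pi_iqadd.

Lemma pi_iqmul : {morph \pi : x y / x * y >-> iqmul x y}.
Proof.
move=> x y; unlock iqmul; apply/eqP/iquot_eqP.
rewrite -[_ * _](addrNK (x * repr (\pi_iquot y))) -mulrBr -addrA -mulrBl.
apply: idealD; first exact/idealM/repr_iquot.
by rewrite mulrC; apply/idealM/repr_iquot.
Qed.
Canonical pi_iqmul_morph := PiMorph2 pi_iqmul.

Lemma iqaddA : associative iqadd.
Proof. by move=> x y z; rewrite -[x]reprK -[y]reprK -[z]reprK !piE addrA. Qed.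
Lemma iqaddC : commutative iqadd.
Proof. by move=> x y; rewrite -[x]reprK -[y]reprK !piE addrC. Qed.
Lemma iqadd0 : left_id iq0 iqadd.
Proof. by move=> x; rewrite -[x]reprK !piE add0r. Qed.
Lemma iqaddN : left_inverse iq0 iqopp iqadd.
Proof. by move=> x; rewrite -[x]reprK !piE addNr. Qed.
Lemma iqmulA : associative iqmul.
Proof. by move=> x y z; rewrite -[x]reprK -[y]reprK -[z]reprK !piE mulrA. Qed.
Lemma iqmulC : commutative iqmul.
Proof. by move=> x y; rewrite -[x]reprK -[y]reprK !piE mulrC. Qed.
Lemma iqmul1 : left_id iq1 iqmul.
Proof. by move=> x; rewrite -[x]reprK !piE mul1r. Qed.
Lemma iqmulDl : left_distributive iqmul iqadd.
Proof. by move=> x y z; rewrite -[x]reprK -[y]reprK -[z]reprK !piE mulrDl. Qed.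

HB.instance Definition _ :=
  GRing.isZmodule.Build iquot iqaddA iqaddC iqadd0 iqaddN.
HB.instance Definition _ :=
  GRing.Zmodule_isComPzRing.Build iquot iqmulA iqmulC iqmul1 iqmulDl.

Definition iproj (x : R) : iquot := \pi_iquot x.

Lemma iproj_is_zmod_morphism : zmod_morphism iproj.
Proof. by move=> x y; rewrite /iproj pi_iqadd pi_iqopp. Qed.
Lemma iproj_is_monoid_morphism : monoid_morphism iproj.
Proof.
by split=> [|x y]; rewrite /iproj ?pi_iqmul //; apply/esym; rewrite /1 /= piE.
Qed.
HB.instance Definition _ :=
  GRing.isZmodMorphism.Build R iquot iproj iproj_is_zmod_morphism.
HB.instance Definition _ :=
  GRing.isMonoidMorphism.Build R iquot iproj iproj_is_monoid_morphism.

Lemma iproj_eq0 x : iproj x = 0 <-> J x.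
Proof.
rewrite -[in J x](subr0 x) -(rmorph0 iproj).
by split=> [/eqP/iquot_eqP|/iquot_eqP/eqP].
Qed.

Lemma iproj_surj y : exists x, iproj x = y.
Proof. by exists (repr y); rewrite /iproj reprK. Qed.

End Quotient.

Section KAlgebras.
Variable K : fieldType.
Implicit Types A B C P : kalg K.

Lemma exists_quotient A (J : ideal_of A) :
  exists B (q : khom A B), surjective_hom q /\ forall x, q x = 0 <-> J x.
Proof.
pose B : kalg K := @KAlg K (iquot J) (@iproj A J \o kalg_str A).
exists B, (@KHom K A B (@iproj A J) (fun=> erefl)).
by split=> [y|x]; [apply: iproj_surj | apply: iproj_eq0].
Qed.

Section InIdeal.
Variables (A : kalg K) (m : nat) (r : 'I_m -> A).

Lemma in_ideal0 : in_ideal r 0.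
Proof. by exists (fun=> 0); rewrite big1 // => i _; rewrite mul0r. Qed.

Lemma in_idealD x y : in_ideal r x -> in_ideal r y -> in_ideal r (x + y).
Proof.
move=> [c ->] [d ->]; exists (fun i => c i + d i); rewrite -big_split.
by apply: eq_bigr => i _; rewrite mulrDl.
Qed.

Lemma in_idealM x y : in_ideal r y -> in_ideal r (x * y).
Proof.
move=> [c ->]; exists (fun i => x * c i); rewrite mulr_sumr.
by apply: eq_bigr => i _; rewrite mulrA.
Qed.

Lemma in_ideal_gen i : in_ideal r (r i).
Proof.
exists (fun j => (j == i)%:R); rewrite (bigD1 i) //= eqxx mul1r big1 ?addr0 //.
by move=> j /negPf->; rewrite mul0r.
Qed.

Definition ideal_gen : ideal_of A :=
  @IdealOf A (in_ideal r) in_ideal0 in_idealD in_idealM.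

End InIdeal.

(** The elements having some power in the ideal of the f_i^(k_i) are closed under sums: in each term
    of the binomial expansion of (x + y)^(i + j), either x has exponent at least i or y has exponent
    at least j. Since 1 is a sum of multiples of the f_i, it is such an element. *)
Lemma in_ideal_expr A (m : nat) (f : 'I_m -> A) (k : 'I_m -> nat) :
  in_ideal f 1 -> in_ideal (fun i => f i ^+ k i) 1.
Proof.
move=> [c /esym E]; pose g i := f i ^+ k i.
suff [N]: exists N, in_ideal g (1 ^+ N) by rewrite expr1n.
rewrite -E; elim/big_ind: _ => [|x y [i xi] [j yj]|i _].
- by exists 1; rewrite expr1; apply: in_ideal0.
- exists (i + j)%N; rewrite exprDn; elim/big_ind: _ => [|u v|l _].
  + exact: in_ideal0.
  + exact: in_idealD.
  rewrite -mulr_natl; apply: in_idealM.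
  case: (leqP j l) => jl.
    by apply: in_idealM; rewrite -(subnK jl) exprD; apply: in_idealM.
  have il : (i <= i + j - l)%N by rewrite -addnBA ?leq_addr // ltnW.
  by rewrite mulrC; apply: in_idealM; rewrite -(subnK il) exprD; apply: in_idealM.
by exists (k i); rewrite exprMn; apply/in_idealM/(in_ideal_gen g).
Qed.

Lemma annihilated_locally A (m : nat) (f : 'I_m -> A) (x : A) :
    in_ideal f 1 -> (forall i, exists k, f i ^+ k * x = 0) -> x = 0.
Proof.
move=> f1 /fin_all_exists[k kP].
have [c E] := in_ideal_expr k f1.
rewrite -[x]mul1r E mulr_suml big1 // => i _.
by rewrite -mulrA kP mulr0.
Qed.

(** The localization is built as A[T]/(fT - 1); in the zero ring, A itself will do. *)
Lemma exists_localization A (f : A) :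
  exists B (h : khom A B), is_localization h f.
Proof.
case: A f => R s /= f.
have [z|[R' E]] := comPzRing_zero_or_nz R.
  have [h _] := khom_id (KAlg s); exists (KAlg s), h; split.
  - by exists 1; apply: zero_ring_eq.
  - by move=> b; exists b, 0; apply: zero_ring_eq.
  - by move=> a _; exists 0; apply: zero_ring_eq.
subst R.
pose P : kalg K := @KAlg K {poly R'} (polyC \o s).
pose g : P := f%:P * 'X - 1.
have [B [q [qsurj qker]]] := exists_quotient (ideal_gen (fun _ : 'I_1 => g)).
have {}qker x : q x = 0 <-> exists c : {poly R'}, x = c * g.
  rewrite qker; split=> [[c ->]|[c ->]].
    by exists (c 0); rewrite big_ord1.
  by exists (fun=> c); rewrite big_ord1.
pose i : khom (KAlg s) P := @KHom K (KAlg s) P (@polyC R') (fun=> erefl).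
have [h hE] := khom_comp q i.
have fX : h f * q 'X = 1.
  apply/eqP; rewrite hE -rmorphM -subr_eq0 -(rmorph1 q) -rmorphB.
  by apply/eqP/qker; exists 1; rewrite mul1r.
exists B, h; split; first by exists (q 'X).
- move=> b; have [p <-] := qsurj b.
  elim/poly_ind: p => [|p c [a [k E]]].
    by exists 0, 0; rewrite !rmorph0 mul0r.
  exists (a + c * f ^+ k.+1), k.+1.
  have -> : q (p * 'X + c%:P) = q p * q 'X + h c by rewrite hE rmorphD rmorphM.
  rewrite mulrDl rmorphD rmorphM rmorphXn /= -E; congr (_ + _).
  by rewrite exprSr mulrACA [_ * h f]mulrC fX mulr1.
- move=> a; rewrite hE => /qker[c /= E].
  (* Comparing coefficients in a = c (fT - 1) shows that the j-th coefficient of c is -f^j a; since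
     c is a polynomial, these vanish from j = [size c] on. *)
  have c0 : c`_0 = - a.
    have := congr1 (fun p : {poly R'} => p`_0) E.
    rewrite coefC eqxx mulrBr mulr1 coefB mulrA coefMX eqxx sub0r => ->.
    by rewrite opprK.
  have cS j : c`_j.+1 = f * c`_j.
    have := congr1 (fun p : {poly R'} => p`_j.+1) E.
    rewrite coefC mulrBr mulr1 coefB mulrA coefMX /= coefMC.
    by move=> /esym/subr0_eq <-; rewrite mulrC.
  have cE j : c`_j = - (f ^+ j * a).
    by elim: j => [|j IH]; rewrite ?expr0 ?mul1r // cS IH mulrN exprS mulrA.
  exists (size c); apply/eqP; rewrite -oppr_eq0 -cE.
  by rewrite nth_default.
Qed.

(** The lift sends the fraction a/f^k to g(a)/g(f)^k, expressed as a graph since a fraction has many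
    representatives; invertibility of g(f) makes the value unique. *)
Lemma localization_lift A B C (h : khom A B) (f : A) (g : khom A C) (e : C) :
    is_localization h f -> g f * e = 1 ->
  exists k : khom B C, forall a, k (h a) = g a.
Proof.
move=> [[u fu] hfrac hker] fe.
pose G b c := exists a k, b * h f ^+ k = h a /\ c * g f ^+ k = g a.
have gX k x y : x * g f ^+ k = y * g f ^+ k -> x = y.
  move=> /(congr1 (fun z => z * e ^+ k)).
  by rewrite -!mulrA -exprMn fe expr1n !mulr1.
have [||||c|k kP] := @khom_of_graph K B C G.
- move=> b; have [a [k E]] := hfrac b.
  exists (g a * e ^+ k), a, k; split=> //.
  by rewrite -mulrA -exprMn [e * _]mulrC fe expr1n mulr1.
- move=> x y y' [a [k [E1 E2]]] [a' [k' [E1' E2']]].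
  have /hker[l] : h (a * f ^+ k' - a' * f ^+ k) = 0.
    rewrite rmorphB !rmorphM !rmorphXn /= -E1 -E1' mulrAC.
    by rewrite subrr.
  move=> /(congr1 g); rewrite rmorph0 !(rmorphM, rmorphB, rmorphXn) /=.
  rewrite -E2 -E2' => El.
  apply: (@gX (l + (k + k'))%N); apply/eqP; rewrite -subr_eq0 -mulrBl.
  rewrite !exprD -[X in _ == X]El; apply/eqP.
  rewrite mulrCA mulrBl; congr (_ * (_ - _)); first by rewrite mulrA.
  by rewrite [X in _ = X]mulrAC mulrA.
- move=> x x' y y' [a [k [E1 E2]]] [a' [k' [E1' E2']]].
  exists (a * f ^+ k' - a' * f ^+ k), (k + k')%N.
  rewrite !rmorphB !rmorphM !rmorphXn /= -E1 -E1' -E2 -E2' !mulrBl !exprD.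
  by split; rewrite mulrA; congr (_ - _); rewrite mulrA mulrAC.
- move=> x x' y y' [a [k [E1 E2]]] [a' [k' [E1' E2']]].
  exists (a * a'), (k + k')%N.
  by rewrite !rmorphM /= -E1 -E1' -E2 -E2' !exprD !(mulrACA _ _ (_ ^+ _)).
- by exists (kalg_str A c), 0; rewrite !expr0 !mulr1 !khom_str.
exists k => a; have [a' [l [E1 E2]]] := kP (h a).
apply: (@gX l); rewrite E2.
have /hker[j] : h (a * f ^+ l - a') = 0.
  by rewrite rmorphB rmorphM rmorphXn /= E1 subrr.
move=> /(congr1 g); rewrite rmorph0 !(rmorphM, rmorphB, rmorphXn) /=.
rewrite mulrC => E; apply/esym/eqP; rewrite -subr_eq0; apply/eqP.
by apply: (@gX j); rewrite mul0r.
Qed.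

Lemma localization_reduced A B (h : khom A B) (f : A) :
  is_localization h f -> is_reduced A -> is_reduced B.
Proof.
move=> [[u fu] hfrac hker] redA x k xk.
have fX j (y : B) : y * h f ^+ j = 0 -> y = 0.
  move=> /(congr1 (fun z => z * u ^+ j)).
  by rewrite -mulrA -exprMn fu expr1n mulr1 mul0r.
have [a [j E]] := hfrac x; apply: (fX j); rewrite E.
have /hker[l El] : h (a ^+ k) = 0 by rewrite rmorphXn /= -E exprMn xk mul0r.
(* The exponent k + 1 rather than k guarantees a factor f^l even when k = 0. *)
have /redA fa : (f ^+ l * a) ^+ k.+1 = 0.
  rewrite exprMn -exprM mulnS exprD [a ^+ _]exprS [f ^+ l * _]mulrC mulrACA.
  by rewrite El mulr0.
apply: (fX l); rewrite -rmorphXn -rmorphM /= mulrC fa.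
by rewrite rmorph0.
Qed.

Lemma localization_uniq A B C (h : khom A B) (f : A) (k k' : khom B C) :
  is_localization h f -> (forall a, k (h a) = k' (h a)) -> k =1 k'.
Proof.
move=> [[u fu] hfrac _] E b; have [a [j Eb]] := hfrac b.
have -> : b = h a * u ^+ j by rewrite -Eb -mulrA -exprMn fu expr1n mulr1.
rewrite !rmorphM !rmorphXn /= E; congr (_ * _ ^+ _).
rewrite -[LHS]mul1r -(rmorph1 k') -fu mulrC rmorphM /= -E mulrA -rmorphM.
by rewrite mulrC /= [u * _]mulrC fu rmorph1 mulr1.
Qed.

End KAlgebras.

Section PolynomialRing.
Variables (K : fieldType) (R : comNzRingType) (s : {rmorphism K -> R}) (m : nat).

Definition mpoly_kalg : kalg K := @KAlg K {mpoly R[m]} (@mpolyC m R \o s).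

Definition mpoly_khom : khom (KAlg s) mpoly_kalg :=
  @KHom K (KAlg s) mpoly_kalg (@mpolyC m R) (fun=> erefl).

(** Existence is evaluation of polynomials, with a zero target treated apart; uniqueness holds
    because both maps are given by the same sum over monomials. *)
Lemma mpoly_is_polynomial_ring :
  is_polynomial_ring mpoly_khom (fun j => 'X_j : {mpoly R[m]}).
Proof.
move=> C g y; split.
  case: C g y => S t g y.
  have [z|[S' E]] := comPzRing_zero_or_nz S.
    have [||||h _] := @khom_of_fun K mpoly_kalg (KAlg t) (fun=> 0);
      try by move=> *; apply: (@zero_ring_eq S).
    by exists h; split=> *; apply: (@zero_ring_eq S).
  subst S.
  have mC c : mmap g y c%:MP = g c := mmapC _ _ _.
  have [|||c|h hE] := @khom_of_fun K mpoly_kalg (KAlg t) (mmap g y).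
  - exact: rmorphB.
  - exact: rmorph1.
  - exact: rmorphM.
  - by rewrite [LHS]mC; apply: (khom_str g).
  exists h; split=> [a|j]; rewrite hE; first exact: mC.
  by rewrite [LHS]mmapX mmap1U.
move=> h h' hi hX h'i h'X p.
have key (k : khom mpoly_kalg C) :
    (forall a, k (mpoly_khom a) = g a) -> (forall j, k 'X_j = y j) ->
  k p = \sum_(u <- msupp p) g p@_u * \prod_(i < m) y i ^+ u i.
  move=> ki kX; rewrite [p in LHS]mpolyE rmorph_sum /=; apply: eq_bigr => u _.
  rewrite -mul_mpolyC rmorphM /= -ki mpolyXE_id rmorph_prod /=; congr (_ * _).
  by apply: eq_bigr => i _; rewrite rmorphXn /= kX.
by rewrite !key.
Qed.

End PolynomialRing.

                                      

(** * Evaluation of polynomials in noncommutative rings *)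

Section PolyEval.
Variables (F : nzRingType) (S : pzRingType) (f : {rmorphism F -> S}) (u : S).
Hypothesis cfu : forall c, f c * u = u * f c.
Implicit Types p q : {poly F}.

(** The target will be a matrix ring over an arbitrary test algebra, hence possibly noncommutative
    or zero; multiplicativity relies on u commuting with the images of the coefficients. *)
Definition peval p : S := \sum_(i < size p) f p`_i * u ^+ i.

Lemma pevalE N p : (size p <= N)%N -> peval p = \sum_(i < N) f p`_i * u ^+ i.
Proof.
move=> pN; rewrite /peval (big_ord_widen N (fun i => f p`_i * u ^+ i)) //.
rewrite big_mkcond; apply: eq_bigr => i _; case: ltnP => // pi.
by rewrite nth_default // rmorph0 mul0r.
Qed.

Lemma pevalD p q : peval (p + q) = peval p + peval q.
Proof.
pose N := maxn (size p) (size q).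
rewrite !(@pevalE N) ?leq_maxl ?leq_maxr ?size_polyD // -big_split.
by apply: eq_bigr => i _; rewrite coefD rmorphD mulrDl.
Qed.

Lemma pevalC c : peval c%:P = f c.
Proof. by rewrite (@pevalE 1) ?size_polyC_leq1 // big_ord1 coefC mulr1. Qed.

Lemma peval0 : peval 0 = 0.
Proof. by rewrite pevalC rmorph0. Qed.

Lemma pevalN p : peval (- p) = - peval p.
Proof. by apply/eqP; rewrite -addr_eq0 -pevalD addNr peval0. Qed.

Lemma pevalMX p : peval (p * 'X) = peval p * u.
Proof.
rewrite (@pevalE (size p).+1) ?size_polyMX_leq //.
  rewrite big_ord_recl coefMX rmorph0 mul0r add0r mulr_suml.
  by apply: eq_bigr => i _; rewrite coefMX /= exprSr mulrA.
by rewrite (leq_trans (size_polyMleq _ _)) // size_polyX addn2.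
Qed.

Lemma pevalX : peval 'X = u.
Proof. by rewrite -['X]mul1r pevalMX pevalC rmorph1 mul1r. Qed.

Lemma pevalCM c p : peval (c%:P * p) = f c * peval p.
Proof.
rewrite (@pevalE (size p)) ?mul_polyC ?size_scale_leq // mulr_sumr.
by apply: eq_bigr => i _; rewrite coefZ rmorphM mulrA.
Qed.

Lemma peval_comm p : peval p * u = u * peval p.
Proof.
rewrite mulr_suml mulr_sumr; apply: eq_bigr => i _.
by rewrite -mulrA -exprSr exprS !mulrA cfu.
Qed.

Lemma pevalM p q : peval (p * q) = peval p * peval q.
Proof.
elim/poly_ind: p => [|p c IH]; first by rewrite mul0r peval0 mul0r.
rewrite mulrDl !pevalD pevalCM pevalC mulrDl; congr (_ + _).
by rewrite -mulrA -commr_polyX mulrA !pevalMX IH -!mulrA peval_comm.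
Qed.

End PolyEval.

Lemma peval_taylor (F : nzRingType) (S : pzRingType) (f : {rmorphism F -> S})
    (u h : S) (p : {poly F}) :
    (forall c, f c * u = u * f c) -> (forall c, f c * h = h * f c) ->
    u * h = h * u -> h * h = 0 ->
  peval f (u + h) p = peval f u p + peval f u p^`() * h.
Proof.
move=> cu ch uh hh; elim/poly_ind: p => [|p c IH].
  by rewrite deriv0 !peval0 mul0r addr0.
rewrite derivD derivC addr0 derivM derivX mulr1.
rewrite !pevalD !pevalC !pevalMX // IH addrAC; congr (_ + _).
rewrite mulrDl !mulrDr !mulrDl -addrA; congr (_ + _).
by rewrite -!mulrA hh mulr0 addr0 -uh addrC.
Qed.

(** The map k is a bare function with the needed identities, so that both entrywise base change and
    conjugation of matrices are instances. *)
Lemma peval_morph (F : nzRingType) (S T : pzRingType) (f : {rmorphism F -> S})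
    (g : {rmorphism F -> T}) (k : S -> T) (u : S) (p : {poly F}) :
    k 0 = 0 -> {morph k : x y / x + y} -> (forall c, k (f c) = g c) ->
    (forall x y, k (x * y) = k x * k y) ->
  peval g (k u) p = k (peval f u p).
Proof.
move=> k0 kD kf kM; elim/poly_ind: p => [|p c IH]; first by rewrite !peval0 k0.
by rewrite !pevalD !pevalMX !pevalC kD kM IH kf.
Qed.

(** * Companion matrices, their commutants, and the exchange of generators *)

Section Companion.
Variables (A : comPzRingType) (n' : nat).
Local Notation n := n'.+1.
Implicit Types (a b r : 'rV[A]_n) (M N C G H : 'M[A]_n).

(** Multiplication by x on A[x]/(p_b) in the basis 1, x, ..., x^(n-1), acting on row vectors. An
    element of this algebra is represented by its multiplication matrix, whose row 0 lists its
    coordinates. *)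
Definition companion b : 'M[A]_n :=
  \matrix_(i, j) if (i.+1 == n)%N then - b 0 j else (j == i.+1 :> nat)%:R.

Definition row_eval r M : 'M[A]_n := \sum_(i < n) r 0 i *: M ^+ i.

(** When M represents an element of A[x]/(p_b), the rows are the coordinates of its powers; this
    matrix is invertible exactly when the element generates the algebra with its first n powers as a
    basis. *)
Definition krylov M : 'M[A]_n := \matrix_(i, j) (M ^+ i) 0 j.

Definition monic_eval b M : 'M[A]_n := M ^+ n + row_eval b M.

Lemma rowM i M N : row i (M * N) = row i M *m N.
Proof. exact: row_mul. Qed.

Lemma scalemxMl c M N : (c *: M) * N = c *: (M * N).
Proof. by rewrite [RHS]scalemxAl. Qed.

Lemma scalemxMr c M N : M * (c *: N) = c *: (M * N).
Proof. by rewrite [RHS]scalemxAr. Qed.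

Lemma row_krylov M (i : 'I_n) : row i (krylov M) = row 0 (M ^+ i).
Proof. by apply/rowP => j; rewrite !mxE. Qed.

Lemma row0_krylov M : row 0 (krylov M) = row 0 1.
Proof. by rewrite row_krylov expr0. Qed.

Lemma row_companion_lt b (i j : 'I_n) :
  j = i.+1 :> nat -> row i (companion b) = row j 1.
Proof.
move=> E; apply/rowP => k; rewrite !mxE -E ltn_eqF //.
by rewrite -val_eqE /= eq_sym.
Qed.

Lemma row_companion_max b : row ord_max (companion b) = - b.
Proof. by apply/rowP => k; rewrite !mxE eqxx. Qed.

Lemma row1M i M : row i 1 *m M = row i M.
Proof. by rewrite -rowM mul1r. Qed.

Lemma krylov_companion b : krylov (companion b) = 1.
Proof.
apply/row_matrixP => -[i lti]; rewrite row_krylov /=.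
elim: i lti => [|i IH] lti; first by congr (row _ _); apply: val_inj.
by rewrite exprSr rowM (IH (ltnW lti)) row1M; apply: row_companion_lt.
Qed.

(** With C the companion matrix and e_i the unit rows, e_i M = e_0 C^i M = e_0 M C^i. Hence a matrix
    in the commutant is determined by row 0, which reduces later matrix identities to identities of
    rows. *)
Lemma commute_companion_eq0 b M :
  M * companion b = companion b * M -> row 0 M = 0 -> M = 0.
Proof.
move=> cM M0; apply/row_matrixP => i; rewrite -row1M -(krylov_companion b).
rewrite row_krylov -rowM -(commrX i cM : _ = _ * M) rowM M0 row0.
by rewrite mul0mx.
Qed.

Lemma row0_row_eval r M : row 0 (row_eval r M) = r *m krylov M.
Proof.
rewrite mulmx_sum_row linear_sum; apply: eq_bigr => i _.
by rewrite linearZ /= row_krylov.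
Qed.

Lemma commr_row_eval r M N : M * N = N * M -> row_eval r M * N = N * row_eval r M.
Proof.
move=> cMN; rewrite mulr_suml mulr_sumr; apply: eq_bigr => i _.
rewrite scalemxMl scalemxMr; congr (_ *: _).
exact/esym/commrX.
Qed.

Lemma commr_monic_eval r M N :
  M * N = N * M -> monic_eval r M * N = N * monic_eval r M.
Proof.
move=> cMN; rewrite mulrDl mulrDr commr_row_eval //; congr (_ + _).
exact/esym/commrX.
Qed.

Lemma row0_monic_eval b M :
  row 0 (monic_eval b M) = row 0 (M ^+ n) + b *m krylov M.
Proof. by rewrite linearD /= row0_row_eval. Qed.

Lemma monic_eval_companion b : monic_eval b (companion b) = 0.
Proof.
apply: (@commute_companion_eq0 b); first exact: commr_monic_eval.
rewrite row0_monic_eval krylov_companion mulmx1 exprSr rowM.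
have -> : row 0 (companion b ^+ n') = row ord_max 1.
  by rewrite -(krylov_companion b) row_krylov.
by rewrite row1M row_companion_max addNr.
Qed.

(** Both sides commute with the companion matrix and share row 0. The commutant is therefore exactly
    A[x]/(p_b), and in particular commutative. *)
Lemma commute_companion_row_eval b M :
  M * companion b = companion b * M -> M = row_eval (row 0 M) (companion b).
Proof.
move=> cM; apply/eqP; rewrite -subr_eq0; apply/eqP.
apply: (@commute_companion_eq0 b).
  by rewrite mulrBl mulrBr cM commr_row_eval.
by rewrite linearB /= row0_row_eval krylov_companion mulmx1 subrr.
Qed.

(** Right multiplication by M shifts the rows e_0 M^i by one, as the companion matrix does from the
    left; the hypothesis on row 0 rewrites the last shifted row e_0 M^n in terms of the others. *)
Lemma companion_krylov b M :
  row 0 (monic_eval b M) = 0 -> companion b * krylov M = krylov M * M.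
Proof.
rewrite row0_monic_eval => /eqP; rewrite addr_eq0 => /eqP E.
apply/row_matrixP => i; rewrite !rowM row_krylov -[RHS]rowM -exprSr.
have [lti|] := ltnP i.+1 n.
  by rewrite (@row_companion_lt b i (Ordinal lti)) // row1M row_krylov.
move=> ni; have -> : i = ord_max by apply/val_inj/eqP; rewrite eqn_leq -ltnS ltn_ord.
by rewrite row_companion_max mulNmx -E.
Qed.

Section Conjugation.
Variables G H : 'M[A]_n.
Hypotheses (GH : G * H = 1) (HG : H * G = 1).

Lemma conjM M N : G * (M * N) * H = (G * M * H) * (G * N * H).
Proof. by rewrite !mulrA -[G * M * H * G]mulrA HG mulr1. Qed.

Lemma conjX M i : (G * M * H) ^+ i = G * M ^+ i * H.
Proof.
by elim: i => [|i IH]; rewrite ?expr0 ?mulr1 ?GH // !exprS IH conjM.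
Qed.

Lemma conj_comm M N : M * N = N * M ->
  (G * M * H) * (G * N * H) = (G * N * H) * (G * M * H).
Proof. by rewrite -!conjM => ->. Qed.

Lemma conj_monic_eval b M :
  monic_eval b (G * M * H) = G * monic_eval b M * H.
Proof.
rewrite /monic_eval /row_eval conjX mulrDr mulrDl mulr_sumr mulr_suml.
congr (_ + _); apply: eq_bigr => i _.
by rewrite conjX scalemxMr scalemxMl.
Qed.

End Conjugation.

                                                                           
                                                                         
                                                                  
Section Duality.
Variables (a b : 'rV[A]_n) (M H : 'M[A]_n).
Local Notation G := (krylov M).
Hypotheses (GH : G * H = 1) (HG : H * G = 1).
Hypotheses (Mroot : monic_eval b M = 0).
Hypothesis cM : M * companion a = companion a * M.

(** Here M is a generator of A[x]/(p_a) with relation b. Passing to the basis of powers of M turns M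
    into [companion b] and multiplication by x into N, so N is the old generator x seen as an
    element of A[x]/(p_b). *)
Let N := G * companion a * H.

Lemma companion_conj : companion b = G * M * H.
Proof.
by rewrite -(@companion_krylov b) ?Mroot ?row0 // -mulrA GH mulr1.
Qed.

Lemma dual_comm : N * companion b = companion b * N.
Proof. by rewrite companion_conj conj_comm. Qed.

(** Row 0 of G is e_0, so e_0 N^i = e_0 G C^i H = e_0 C^i H = e_i H, where C is [companion a]. In
    particular N is again a generator. *)
Lemma dual_krylov : krylov N = H.
Proof.
apply/row_matrixP => i; rewrite row_krylov conjX // !rowM row0_krylov row1M.
by rewrite -row_krylov krylov_companion row1M.
Qed.

Lemma dual_root : monic_eval a N = 0.
Proof. by rewrite conj_monic_eval // monic_eval_companion mulr0 mul0r. Qed.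

Lemma dual_dual : M = H * companion b * G.
Proof. by rewrite companion_conj !mulrA HG mul1r -mulrA HG mulr1. Qed.

End Duality.

Lemma krylov_inverse M d : \det (krylov M) * d = 1 ->
  krylov M * (d *: \adj (krylov M)) = 1 /\ (d *: \adj (krylov M)) * krylov M = 1.
Proof.
move=> E; split.
  by rewrite scalemxMr [_ * _]mul_mx_adj scale_scalar_mx mulrC E.
by rewrite scalemxMl [_ * _]mul_adj_mx scale_scalar_mx mulrC E.
Qed.

End Companion.

                                           

(** * Base change, and evaluation of polynomials over K at matrices *)

Section MapMatrix.
Variables (A B : comPzRingType) (h : {rmorphism A -> B}) (n' : nat).
Local Notation n := n'.+1.
Implicit Types (b r : 'rV[A]_n) (M : 'M[A]_n).

Lemma map_mxX M i : map_mx h (M ^+ i) = map_mx h M ^+ i.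
Proof.
elim: i => [|i IH]; first by rewrite !expr0 [LHS]map_mx1.
by rewrite !exprS [LHS]map_mxM IH.
Qed.

Lemma map_companion b : map_mx h (companion b) = companion (map_mx h b).
Proof.
by apply/matrixP => i j; rewrite !mxE; case: ifP; rewrite ?rmorphN ?rmorph_nat.
Qed.

Lemma map_row_eval r M : map_mx h (row_eval r M) = row_eval (map_mx h r) (map_mx h M).
Proof.
rewrite /row_eval raddf_sum; apply: eq_bigr => i _.
by rewrite [LHS]map_mxZ map_mxX mxE.
Qed.

Lemma map_krylov M : map_mx h (krylov M) = krylov (map_mx h M).
Proof. by apply/matrixP => i j; rewrite !mxE -map_mxX mxE. Qed.

End MapMatrix.

Section MatrixEvaluation.
Variables (K : fieldType) (n' : nat).
Local Notation n := n'.+1.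

Definition mx_str (A : kalg K) : {rmorphism K -> 'M[A]_n} :=
  @scalar_mx A n \o kalg_str A.

Lemma mx_str_comm (A : kalg K) c (M : 'M[A]_n) : mx_str A c * M = M * mx_str A c.
Proof. exact/esym/scalar_mxC. Qed.

Definition mx_eval (A : kalg K) (M : 'M[A]_n) (p : {poly K}) : 'M[A]_n :=
  peval (mx_str A) M p.

Lemma mx_eval_map (A B : kalg K) (h : khom A B) (M : 'M[A]_n) p :
  mx_eval (map_mx h M) p = map_mx h (mx_eval M p).
Proof.
apply: (peval_morph (k := map_mx h)); first by rewrite map_mx0.
- exact: map_mxD.
- by move=> c; rewrite /= map_scalar_mx /= khom_str.
- exact: map_mxM.
Qed.

Lemma mx_eval_conj (A : kalg K) (G H M : 'M[A]_n) p :
  G * H = 1 -> H * G = 1 -> mx_eval (G * M * H) p = G * mx_eval M p * H.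
Proof.
move=> GH HG.
apply: (peval_morph (k := fun X => G * X * H)); first by rewrite mulr0 mul0r.
- by move=> x y; rewrite mulrDr mulrDl.
- by move=> c; rewrite -mx_str_comm -mulrA GH mulr1.
- by move=> x y; apply: conjM.
Qed.

Lemma mx_evalM (A : kalg K) (M : 'M[A]_n) p q :
  mx_eval M (p * q) = mx_eval M p * mx_eval M q.
Proof. by apply: pevalM => c; apply: mx_str_comm. Qed.

Lemma mx_eval_commute (A : kalg K) (M N : 'M[A]_n) p :
  M * N = N * M -> mx_eval M p * N = N * mx_eval M p.
Proof.
move=> MN; rewrite /mx_eval; elim/poly_ind: p => [|p c IH].
  by rewrite peval0 mul0r mulr0.
by rewrite pevalD pevalMX pevalC mulrDl mulrDr mx_str_comm -mulrA MN mulrA IH mulrA.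
Qed.

Lemma mx_evalD (A : kalg K) (M : 'M[A]_n) p q :
  mx_eval M (p + q) = mx_eval M p + mx_eval M q.
Proof. exact: pevalD. Qed.

Lemma mx_evalX (A : kalg K) (M : 'M[A]_n) : mx_eval M 'X = M.
Proof. exact: pevalX. Qed.

Lemma mx_evalXn (A : kalg K) (M : 'M[A]_n) i : mx_eval M 'X^i = M ^+ i.
Proof.
elim: i => [|i IH]; first by rewrite !expr0 /mx_eval pevalC rmorph1.
by rewrite !exprS mx_evalM IH mx_evalX.
Qed.

Definition row_poly (r : 'rV[K]_n) : {poly K} := \sum_(i < n) r 0 i *: 'X^i.

Lemma mx_eval_row_poly (A : kalg K) (M : 'M[A]_n) r :
  mx_eval M (row_poly r) = row_eval (map_mx (kalg_str A) r) M.
Proof.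
rewrite (big_morph (mx_eval M) (pevalD _ _) (peval0 _ _)).
apply: eq_bigr => i _; rewrite -mul_polyC mx_evalM mx_evalXn /mx_eval pevalC mxE.
by rewrite [LHS]mul_scalar_mx.
Qed.

Lemma mx_eval_p_ (A : kalg K) (M : 'M[A]_n) (a : 'rV[K]_n) :
  mx_eval M (p_ a) = monic_eval (map_mx (kalg_str A) a) M.
Proof. by rewrite mx_evalD mx_evalXn mx_eval_row_poly. Qed.

End MatrixEvaluation.

(** * Newton lifting of roots along square-zero extensions *)

Section SquareZero.
Variables (K : fieldType) (A B : kalg K) (h : khom A B).
Hypothesis hsurj : surjective_hom h.
Hypothesis hsq : forall x y : A, h x = 0 -> h y = 0 -> x * y = 0.

(** Any lift z of y satisfies xz = 1 - e with e in the kernel, so e^2 = 0 and z(1 + e) inverts x. *)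
Lemma unit_lift (x : A) (y : B) : h x * y = 1 -> exists y' : A, x * y' = 1.
Proof.
have [z <-] := hsurj y => E; pose e := 1 - x * z.
have he : h e = 0 by rewrite rmorphB rmorph1 rmorphM /= E subrr.
exists (z * (1 + e)); rewrite mulrA.
have -> : x * z = 1 - e by rewrite opprB addrC subrK.
by rewrite -subr_sqr expr1n expr2 hsq // subr0.
Qed.

Lemma mx_lift m l (M : 'M[B]_(m, l)) : exists N : 'M[A]_(m, l), map_mx h N = M.
Proof.
have [f fP] := fin_all_exists (fun ij : 'I_m * 'I_l => hsurj (M ij.1 ij.2)).
exists (\matrix_(i, j) f (i, j)); apply/matrixP => i j.
by rewrite !mxE fP.
Qed.

Lemma mx_square_zero m (M N : 'M[A]_m) :
  map_mx h M = 0 -> map_mx h N = 0 -> M * N = 0.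
Proof.
move=> M0 N0; apply/matrixP => i j; rewrite mxE [RHS]mxE big1 // => k _.
apply: hsq.
  by have := congr1 (fun X : 'M_m => X i k) M0; rewrite !mxE.
by have := congr1 (fun X : 'M_m => X k j) N0; rewrite !mxE.
Qed.

Variables (n' : nat).
Local Notation n := n'.+1.
Variable p : {poly K}.
Hypothesis psep : separable_poly p.

Lemma separable_bezout : exists u v : {poly K}, u * p + v * p^`() = 1.
Proof.
have := psep; rewrite unlock => /Bezout_eq1_coprimepP[[u v] /= E].
by exists u, v.
Qed.

Lemma mx_eval_taylor (M H : 'M[A]_n) q :
    M * H = H * M -> map_mx h H = 0 ->
  mx_eval (M + H) q = mx_eval M q + mx_eval M q^`() * H.
Proof.
move=> MH H0; apply: peval_taylor => // [c|c|]; try exact: mx_str_comm.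
exact: mx_square_zero.
Qed.

                                                                          
           
(** One Newton step. From up + vp' = 1, the element v(M) inverts p'(M) modulo p(M), and N = M -
    v(M)p(M) is an exact root because p(M)^2 = 0. The correction is a polynomial in M, so N commutes
    with whatever commutes with M; this keeps the root in the commutant of a companion matrix. *)
Lemma mx_root_lift (M : 'M[A]_n) : map_mx h (mx_eval M p) = 0 ->
  exists N : 'M[A]_n, [/\ mx_eval N p = 0, map_mx h N = map_mx h M &
    forall X : 'M[A]_n, M * X = X * M -> N * X = X * N].
Proof.
move=> M0; have [u [v E]] := separable_bezout.
pose H := - (mx_eval M v * mx_eval M p).
have H0 : map_mx h H = 0.
  by rewrite map_mxN [map_mx h (_ * _)]map_mxM M0 mulmx0 oppr0.
have HX X : M * X = X * M -> H * X = X * H.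
  move=> MX; rewrite mulNr mulrN; congr (- _).
  by rewrite -mulrA (mx_eval_commute p MX) mulrA (mx_eval_commute v MX) mulrA.
exists (M + H); split.
- rewrite mx_eval_taylor //; last exact/esym/HX.
  have -> : mx_eval M p^`() * H = - ((1 - mx_eval M u * mx_eval M p) * mx_eval M p).
    rewrite mulrN mulrA -mx_evalM; congr (- (_ * _)).
    rewrite -mx_evalM -[1](_ : mx_eval M 1 = 1); last first.
      by rewrite /mx_eval pevalC rmorph1.
    by rewrite -E /mx_eval pevalD addrC addKr mulrC.
  rewrite mulrBl mul1r opprB addrC subrK -mulrA.
  by rewrite (mx_square_zero M0 M0) mulr0.
- by rewrite map_mxD H0 addr0.
- by move=> X MX; rewrite mulrDl mulrDr MX HX.
Qed.

(** With H = N - M, Taylor expansion gives 0 = p(N) = p'(M)H, and p'(M) has left inverse v(M)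
    because p(M) = 0. Commutation of M and N is what permits the expansion. *)
Lemma mx_root_uniq (M N : 'M[A]_n) :
    mx_eval M p = 0 -> mx_eval N p = 0 -> map_mx h M = map_mx h N ->
    M * N = N * M ->
  M = N.
Proof.
move=> Mp Np MN cMN; have [u [v E]] := separable_bezout.
pose H := N - M; have H0 : map_mx h H = 0 by rewrite map_mxB MN subrr.
have NE : N = M + H by rewrite addrC subrK.
have := Np; rewrite NE mx_eval_taylor //; last first.
  by rewrite mulrBr mulrBl cMN.
rewrite Mp add0r => /(congr1 (fun X => mx_eval M v * X)).
rewrite mulr0 mulrA -mx_evalM.
have -> : v * p^`() = 1 - u * p by rewrite -E addrAC subrr add0r.
rewrite /mx_eval pevalD pevalN pevalC rmorph1 -!/(mx_eval _ _) mx_evalM Mp mulr0.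
by rewrite subr0 mul1r => ->; rewrite addr0.
Qed.

End SquareZero.

                                   

(** * Generators of A[x]/(p_a): relations, lifting and uniqueness *)

Section Generators.
Variables (K : fieldType) (n' : nat) (a : 'rV[K]_n'.+1).
Local Notation n := n'.+1.
Implicit Types A B : kalg K.

Definition base_companion A : 'M[A]_n := companion (map_mx (kalg_str A) a).

                                                                          
Definition elt A (r : 'rV[A]_n) : 'M[A]_n := row_eval r (base_companion A).

Definition elt_det A (r : 'rV[A]_n) : A := \det (krylov (elt r)).

                                                                            
                                 
(** The coordinates of -r^n in the basis of powers of r, where the inverse of the matrix of powers
    is d times its adjugate, d being the inverse determinant. This is polynomial in r and d, hence
    compatible with base change. *)
Definition elt_coefs A (r : 'rV[A]_n) (d : A) : 'rV[A]_n :=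
  - (row 0 (elt r ^+ n) *m (d *: \adj (krylov (elt r)))).

Lemma map_elt A B (h : khom A B) (r : 'rV[A]_n) :
  map_mx h (elt r) = elt (map_mx h r).
Proof.
rewrite map_row_eval map_companion -map_mx_comp; congr (row_eval _ (companion _)).
by apply/rowP => i; rewrite !mxE /= khom_str.
Qed.

Lemma map_elt_det A B (h : khom A B) (r : 'rV[A]_n) :
  h (elt_det r) = elt_det (map_mx h r).
Proof. by rewrite /elt_det -map_elt -map_krylov det_map_mx. Qed.

Lemma map_elt_coefs A B (h : khom A B) (r : 'rV[A]_n) d :
  map_mx h (elt_coefs r d) = elt_coefs (map_mx h r) (h d).
Proof.
rewrite /elt_coefs map_mxN map_mxM map_mxZ map_mx_adj map_krylov map_elt.
by rewrite map_row map_mxX map_elt.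
Qed.

Lemma elt_comm A (r : 'rV[A]_n) :
  elt r * base_companion A = base_companion A * elt r.
Proof. exact: commr_row_eval. Qed.

Lemma row0_elt A (r : 'rV[A]_n) : row 0 (elt r) = r.
Proof. by rewrite row0_row_eval krylov_companion mulmx1. Qed.

Lemma elt_row0 A (M : 'M[A]_n) :
  M * base_companion A = base_companion A * M -> elt (row 0 M) = M.
Proof. by move=> /commute_companion_row_eval {2}->. Qed.

Lemma elt_coefsP A (r b : 'rV[A]_n) d : elt_det r * d = 1 ->
  elt_coefs r d = b <-> monic_eval b (elt r) = 0.
Proof.
move=> rd; have [GH HG] := krylov_inverse rd; split=> [<-|E].
  apply: (@commute_companion_eq0 _ _ (map_mx (kalg_str A) a)).
    exact/commr_monic_eval/elt_comm.
  rewrite row0_monic_eval mulNmx -mulmxA [_ *m krylov _]HG.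
  by rewrite mulmx1 subrr.
have := row0_monic_eval b (elt r); rewrite E row0 => /esym/eqP.
rewrite addr_eq0 => /eqP Er.
by rewrite /elt_coefs Er mulNmx opprK -mulmxA [krylov _ *m _]GH mulmx1.
Qed.

Section Lifting.
Variables (A B : kalg K) (h : khom A B).
Hypothesis hsurj : surjective_hom h.
Hypothesis hsq : forall x y : A, h x = 0 -> h y = 0 -> x * y = 0.
Hypothesis psep : separable_poly (p_ a).

(** Existence half of formal etaleness, by exchanging roles: the lifting takes place in A[x]/(p_b),
    where the equation to solve is the separable p_a with coefficients in K. *)
Lemma generator_lift (r : 'rV[B]_n) (d : B) (b : 'rV[A]_n) :
    elt_det r * d = 1 -> map_mx h b = elt_coefs r d ->
  exists s e, [/\ elt_det s * e = 1, map_mx h s = r & elt_coefs s e = b].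
Proof.
move=> rd hb; have [GH HG] := krylov_inverse rd.
set G := krylov (elt r) in GH HG; set H := d *: _ in GH HG.
have rt : monic_eval (map_mx h b) (elt r) = 0 by apply/(elt_coefsP _ rd).
have rC := elt_comm r.
(* Q is x written in terms of the generator r: a root of p_a in the commutant of the companion
   matrix of the reduction of b. *)
pose Q := G * base_companion B * H.
have Qc : Q * companion (map_mx h b) = companion (map_mx h b) * Q.
  exact: dual_comm.
have QK : krylov Q = H by apply: dual_krylov.
have Qr : mx_eval Q (p_ a) = 0 by rewrite mx_eval_p_ dual_root.
(* Only the coordinates of Q are lifted; evaluating them at [companion b] keeps the approximate root
   inside A[x]/(p_b). *)
have [q qE] := mx_lift hsurj (row 0 Q).
have hQ0 : map_mx h (row_eval q (companion b)) = Q.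
  rewrite map_row_eval map_companion qE.
  by rewrite -commute_companion_row_eval.
have [|T [Tr hT Tc]] := @mx_root_lift K A B h hsq n' (p_ a) psep
    (row_eval q (companion b)).
  by rewrite -mx_eval_map hQ0.
rewrite hQ0 in hT.
have {}Tc : T * companion b = companion b * T by apply/Tc/commr_row_eval.
(* The reduction of [krylov T] is H, whose determinant is invertible; lifting this unit shows that T
   generates A[x]/(p_b). *)
have dT : h (\det (krylov T)) * \det G = 1.
  rewrite -det_map_mx map_krylov hT QK -det_mulmx [_ *m _]HG.
  exact: det1.
have [e eT] := unit_lift hsurj hsq dT.
have [TU UT] := krylov_inverse eT; set U := e *: _ in TU UT.
rewrite mx_eval_p_ in Tr.
(* Exchange back: R is the generator x of A[x]/(p_b), seen in A[x]/(p_a) through T. Its inverse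
   determinant is that of [krylov T], since [krylov R] = U. *)
pose R := krylov T * companion b * U.
have Rc : R * base_companion A = base_companion A * R by apply: dual_comm.
have RK : krylov R = U by apply: dual_krylov.
have Rr : monic_eval b R = 0 by apply: dual_root.
have eR := elt_row0 Rc.
have Rd : elt_det (row 0 R) * \det (krylov T) = 1.
  by rewrite /elt_det eR RK -det_mulmx [_ *m _]UT det1.
exists (row 0 R), (\det (krylov T)); split=> //; last first.
  by apply/(elt_coefsP _ Rd); rewrite eR.
rewrite map_row -[RHS]row0_elt; congr (row 0 _).
rewrite (dual_dual GH HG rt).
have hU : map_mx h U = G.
  have : map_mx h U * map_mx h (krylov T) = 1.
    by rewrite -[LHS]map_mxM [U *m _]UT; apply: map_mx1.
  rewrite map_krylov hT QK => E.
  by rewrite -[map_mx h U]mulr1 -HG mulrA E mul1r.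
rewrite [LHS]map_mxM [X in X *m _]map_mxM hU map_krylov hT QK.
by rewrite map_companion.
Qed.

(** The exchanged elements Q and Q' are roots of p_a in the same commutative algebra A[x]/(p_b) with
    equal reductions, so they coincide. Their matrices of powers are H and H', hence the bases agree
    and so do s and s'. *)
Lemma generator_uniq (s s' : 'rV[A]_n) e e' :
    elt_det s * e = 1 -> elt_det s' * e' = 1 -> map_mx h s = map_mx h s' ->
    elt_coefs s e = elt_coefs s' e' ->
  s = s'.
Proof.
move=> se se' hs; set b := elt_coefs s e => /esym hb'.
have [GH HG] := krylov_inverse se; have [GH' HG'] := krylov_inverse se'.
set H := e *: _ in GH HG; set H' := e' *: _ in GH' HG'.
set G := krylov (elt s) in GH HG; set G' := krylov (elt s') in GH' HG'.
have rt : monic_eval b (elt s) = 0 by apply/(elt_coefsP _ se).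
have rt' : monic_eval b (elt s') = 0 by apply/(elt_coefsP _ se').
pose Q := G * base_companion A * H; pose Q' := G' * base_companion A * H'.
have sc := elt_comm s; have sc' := elt_comm s'.
have Qc : Q * companion b = companion b * Q by apply: dual_comm.
have Qc' : Q' * companion b = companion b * Q' by apply: dual_comm.
have Qr : mx_eval Q (p_ a) = 0 by rewrite mx_eval_p_ dual_root.
have Qr' : mx_eval Q' (p_ a) = 0 by rewrite mx_eval_p_ dual_root.
have hG : map_mx h G = map_mx h G'.
  by rewrite !map_krylov !map_elt hs.
have hH : map_mx h H = map_mx h H'.
  have E : map_mx h H * map_mx h G = 1.
    by rewrite -[LHS]map_mxM [H *m _]HG; apply: map_mx1.
  have E' : map_mx h G' * map_mx h H' = 1.
    by rewrite -[LHS]map_mxM [G' *m _]GH'; apply: map_mx1.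
  by rewrite -[LHS]mulr1 -E' mulrA -hG E mul1r.
have hQ : map_mx h Q = map_mx h Q'.
  rewrite [LHS]map_mxM [X in X *m _]map_mxM [RHS]map_mxM [X in _ = X *m _]map_mxM.
  by rewrite hG hH.
have QQ' : Q * Q' = Q' * Q.
  by rewrite (commute_companion_row_eval Qc') [RHS]commr_row_eval.
have EQ : Q = Q' := mx_root_uniq hsq psep Qr Qr' hQ QQ'.
have KQ : krylov Q = H by apply: dual_krylov.
have KQ' : krylov Q' = H' by apply: dual_krylov.
have EH : H = H' by rewrite -KQ -KQ' EQ.
have EG : G = G' by rewrite -[G]mulr1 -HG' -EH mulrA GH mul1r.
rewrite -(row0_elt s) -(row0_elt s'); congr (row 0 _).
by rewrite (dual_dual GH HG rt) (dual_dual GH' HG' rt') EH -/G EG.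
Qed.

End Lifting.

End Generators.

                        

(** * Quotients K[x]/(P), and the isomorphism attached to a rational point *)

Section QuotientByMonic.
Variables (K : fieldType) (P : {poly K}).
Hypotheses (Psize : (1 < size P)%N) (Pmonic : P \is monic).

Lemma mk_monic_id : mk_monic P = P.
Proof. by rewrite /mk_monic Psize Pmonic. Qed.

Lemma val_in_qpoly g : in_qpoly P g = g %% P :> {poly K}.
Proof. by rewrite /= mk_monic_id Pdiv.IdomainMonic.modpE. Qed.

Lemma in_qpoly_dvdp g : in_qpoly P g = 0 <-> P %| g.
Proof.
split=> [E|/modp_eq0P E].
  by apply/modp_eq0P; rewrite -val_in_qpoly E.
by apply: val_inj; rewrite [LHS]val_in_qpoly E.
Qed.

Lemma in_qpoly_congr f g : P %| f - g -> in_qpoly P f = in_qpoly P g.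
Proof. by move=> /in_qpoly_dvdp/eqP; rewrite linearB subr_eq0 => /eqP. Qed.

Lemma dvdp_in_qpoly g : P %| (in_qpoly P g : {poly K}) - g.
Proof.
rewrite val_in_qpoly {2}(divp_eq g P) opprD addrCA subrr addr0 dvdpNr.
exact: dvdp_mull.
Qed.

Lemma in_qpolyK (x : {poly %/ P}) : in_qpoly P x = x.
Proof. by apply/val_inj/in_qpoly_small/size_mk_monic. Qed.

End QuotientByMonic.

Lemma dvdp_comp_congr (K : fieldType) (d g u v : {poly K}) :
  d %| u - v -> d %| (g \Po u) - (g \Po v).
Proof.
move=> duv; elim/poly_ind: g => [|g c IH]; first by rewrite !comp_poly0 subrr dvdp0.
rewrite !comp_poly_MXaddC opprD addrACA subrr addr0.
have -> : (g \Po u) * u - (g \Po v) * v =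
    ((g \Po u) - (g \Po v)) * u + (g \Po v) * (u - v).
  by rewrite mulrBl mulrBr addrA subrK.
by apply: dvdp_add; [apply: dvdp_mulr | apply: dvdp_mull].
Qed.

                                                                       
                                
Section PolynomialIsomorphism.
Variables (K : fieldType) (P Q q t : {poly K}).
Hypotheses (Psize : (1 < size P)%N) (Pmonic : P \is monic).
Hypotheses (Qsize : (1 < size Q)%N) (Qmonic : Q \is monic).
Hypotheses (QPq : Q %| P \Po q) (PQt : P %| Q \Po t).
Hypotheses (Qtq : Q %| (t \Po q) - 'X) (Pqt : P %| (q \Po t) - 'X).

(** The four divisibilities say that x -> q and x -> t induce mutually inverse maps between K[x]/(P)
    and K[x]/(Q); composing with q gives g(t(q)), which is g modulo Q. *)
Lemma dvdp_back g : P %| g \Po t -> Q %| g.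
Proof.
move=> /(dvdp_comp_poly q)/(dvdp_trans QPq).
rewrite -comp_polyA => E.
have := dvdp_comp_congr g Qtq; rewrite comp_polyXr.
by rewrite dvdp_subr.
Qed.

(** If Q = kg, then P divides k(t) g(t), hence one of the two factors, and so Q divides k or g. The
    former contradicts degrees, as g is not constant. *)
Lemma irreducible_transfer : irreducible_poly P -> irreducible_poly Q.
Proof.
move=> irrP; split=> // g g1 gQ; rewrite /eqp gQ /=.
have /dvdpP[k Qk] := gQ.
have := PQt; rewrite Qk comp_polyM.
have [Pg _|Pg] := boolP (P %| g \Po t); first by rewrite -Qk; apply: dvdp_back.
rewrite Gauss_dvdpl ?irreducible_poly_coprime // => /dvdp_back Qdk.
have Q0 : Q != 0 by rewrite -size_poly_gt0 ltnW.
have k0 : k != 0 by apply: contraNneq Q0 => k0; rewrite Qk k0 mul0r.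
have g0 : g != 0 by apply: contraNneq Q0 => g0; rewrite Qk g0 mulr0.
have := dvdp_leq k0 Qdk; rewrite {1}Qk size_mul //.
have := size_poly_gt0 g; rewrite g0 => /esym gt0.
move: g1; case: (size g) gt0 => [|[|s]] // _ _.
by rewrite !addnS /= -ltn_subRL subnn.
Qed.

(** Let d divide Q and Q'. Then d divides P(q) and its derivative P'(q)q', and is prime to P'(q) by
    the Bezout identity composed with q; so d divides q'. Differentiating t(q) - x = kQ then gives
    that d divides 1. *)
Lemma separable_transfer : separable_poly P -> separable_poly Q.
Proof.
rewrite unlock => /Bezout_eq1_coprimepP[[u v] /= uv].
apply/coprimepP => d dQ dQ'.
have dPq : d %| (P \Po q) := dvdp_trans dQ QPq.
have cop : coprimep d (P^`() \Po q).
  apply/Bezout_eq1_coprimepP.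
  have /dvdpP[k Ek] := dPq; exists ((u \Po q) * k, v \Po q) => /=.
  by rewrite -mulrA -Ek -!comp_polyM -comp_polyD uv comp_polyC.
have dq : d %| q^`().
  rewrite -(Gauss_dvdpr _ cop) -deriv_comp.
  have /dvdpP[k ->] := QPq; rewrite derivM dvdp_add ?dvdp_mull //.
have /dvdpP[k /(congr1 deriv)] := Qtq.
rewrite derivB derivX deriv_comp derivM => /eqP.
rewrite subr_eq addrC -subr_eq => /eqP E.
rewrite -size_poly_eq1 -dvdp1 -E dvdp_sub ?dvdp_mull // dvdp_add ?dvdp_mull //.
Qed.

Definition qpoly_subst (x : {poly %/ P}) : {poly %/ Q} :=
  in_qpoly Q ((x : {poly K}) \Po q).

Lemma qpoly_subst_in g : qpoly_subst (in_qpoly P g) = in_qpoly Q (g \Po q).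
Proof.
apply: in_qpoly_congr => //; rewrite -comp_polyB.
exact: dvdp_trans QPq (dvdp_comp_poly _ (dvdp_in_qpoly _ _ _)).
Qed.

Lemma qpoly_subst_lrmorphism :
  exists f : {lrmorphism {poly %/ P} -> {poly %/ Q}}, f =1 qpoly_subst.
Proof.
have lin : linear qpoly_subst.
  move=> c x y; rewrite /qpoly_subst -linearP -comp_polyZ -comp_polyD.
  by congr (in_qpoly _ (_ \Po _)).
have mul : monoid_morphism qpoly_subst.
  split=> [|x y].
    by rewrite -(in_qpoly1 P) qpoly_subst_in comp_polyC in_qpoly1.
  rewrite -[x](in_qpolyK x) -[y](in_qpolyK y) -in_qpolyM !qpoly_subst_in.
  by rewrite comp_polyM in_qpolyM.
pose m1 := GRing.isLinear.Build K {poly %/ P} {poly %/ Q} _ qpoly_subst lin.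
pose m2 := GRing.isMonoidMorphism.Build {poly %/ P} {poly %/ Q} qpoly_subst mul.
pose f : {lrmorphism {poly %/ P} -> {poly %/ Q}} := HB.pack qpoly_subst m1 m2.
by exists f.
Qed.

End PolynomialIsomorphism.

Lemma qpoly_substK (K : fieldType) (P Q q t : {poly K}) :
    (1 < size P)%N -> P \is monic -> (1 < size Q)%N -> Q \is monic ->
    P %| Q \Po t -> P %| (q \Po t) - 'X ->
  cancel (@qpoly_subst K P Q q) (@qpoly_subst K Q P t).
Proof.
move=> Ps Pm Qs Qm PQt Pqt x; rewrite /(qpoly_subst q x) qpoly_subst_in //.
rewrite -comp_polyA -[RHS]in_qpolyK; apply: in_qpoly_congr => //.
by rewrite -{2}[x : {poly K}]comp_polyXr; apply: dvdp_comp_congr.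
Qed.

Section RationalPoints.
Variables (K : fieldType) (n' : nat).
Local Notation n := n'.+1.
Implicit Types (a b r : 'rV[K]_n).

Lemma size_row_poly r : (size (row_poly r) <= n)%N.
Proof.
rewrite (leq_trans (size_sum _ _ _)) //; apply/bigmax_leqP => i _.
by rewrite (leq_trans (size_scale_leq _ _)) ?size_polyXn.
Qed.

Lemma size_p_ a : size (p_ a) = n.+1.
Proof. by rewrite /p_ size_polyDl size_polyXn // ltnS size_row_poly. Qed.

Lemma p_monic a : p_ a \is monic.
Proof.
by rewrite monicE lead_coefDl ?lead_coefXn // size_polyXn ltnS size_row_poly.
Qed.

Lemma mx_eval_comp (A : kalg K) (M : 'M[A]_n) f g :
  mx_eval M (f \Po g) = mx_eval (mx_eval M g) f.
Proof.
elim/poly_ind: f => [|f c IH]; first by rewrite comp_poly0 /mx_eval !peval0.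
rewrite comp_poly_MXaddC /mx_eval !pevalD !pevalC !pevalMX; congr (_ + _).
by rewrite -!/(mx_eval _ _) mx_evalM IH.
Qed.

Lemma mx_evalB (A : kalg K) (M : 'M[A]_n) f g :
  mx_eval M (f - g) = mx_eval M f - mx_eval M g.
Proof. by rewrite /mx_eval pevalD pevalN. Qed.

Lemma map_mx_kbase m (M : 'M[K]_(m, n)) : map_mx (kalg_str (kbase K)) M = M.
Proof. by apply/matrixP => i j; rewrite mxE. Qed.

(** The remainder of g modulo p_b has degree below n, and row 0 of its value at the companion matrix
    is its list of coefficients. Divisibility by p_b can thus be checked as a matrix identity. *)
Lemma dvdp_companion b g :
  @mx_eval K n' (kbase K) (companion b) g = 0 -> p_ b %| g.
Proof.
set C : 'M[kbase K]_n := companion b => Cg.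
have Cb : mx_eval C (p_ b) = 0.
  by rewrite mx_eval_p_ map_mx_kbase; apply: monic_eval_companion.
pose s := g %% p_ b; have Cs : mx_eval C s = 0.
  by have := Cg; rewrite {1}(divp_eq g (p_ b)) /mx_eval pevalD
    -!/(mx_eval _ _) mx_evalM Cb mulr0 add0r.
have sn : (size s <= n)%N.
  by rewrite -ltnS -(size_p_ b) ltn_modp -size_poly_gt0 size_p_.
pose r : 'rV[K]_n := \row_i s`_i.
have sE : s = row_poly r.
  apply/polyP => i; rewrite coef_sum.
  under eq_bigr do rewrite coefZ coefXn mxE.
  have [ltin|] := ltnP i n.
    rewrite (bigD1 (Ordinal ltin)) //= eqxx mulr1 big1 ?addr0 // => j.
    by rewrite -val_eqE /= eq_sym => /negPf->; rewrite mulr0.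
  move=> ni; rewrite nth_default ?(leq_trans sn) // big1 // => j _.
  by rewrite gtn_eqF ?mulr0 // (leq_trans (ltn_ord j)).
apply/modp_eq0P; rewrite -/s sE.
have r0 : r = 0.
  have := row0_row_eval r (C : 'M[kbase K]_n); rewrite krylov_companion mulmx1 => <-.
  have := mx_eval_row_poly C r; rewrite map_mx_kbase => <-.
  by rewrite -sE Cs; apply: row0.
by rewrite /row_poly r0 big1 // => i _; rewrite mxE scale0r.
Qed.

Lemma rational_point_approx a r d :
    U a -> @elt_det K n' a (kbase K) r * d = 1 ->
  let b := elt_coefs a (r : 'rV[kbase K]_n) d in U b /\ approx a b.
Proof.
move=> [sepa irra] rd b.
have [GH HG] := krylov_inverse rd.
set R := elt a _ in GH HG; set G := krylov R in GH HG; set H := d *: _ in GH HG.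
have rt : monic_eval b R = 0 by apply/(elt_coefsP _ rd).
have Ca : base_companion a (kbase K) = companion a.
  by rewrite /base_companion map_mx_kbase.
have rc : R * companion a = companion a * R by rewrite -Ca; apply: elt_comm.
pose Q := G * companion a * H.
have Qc : Q * companion b = companion b * Q by apply: dual_comm.
have Qr : monic_eval a Q = 0 by apply: dual_root.
have Cb : companion b = G * R * H by apply: companion_conj.
(* The polynomial t expresses the generator r in terms of x, and q expresses x in terms of r; they
   are the two substitutions defining the isomorphism. *)
pose q := row_poly (row 0 Q); pose t := row_poly r.
pose CA : 'M[kbase K]_n := companion a; pose CB : 'M[kbase K]_n := companion b.
have CBq : mx_eval CB q = Q.
  by rewrite mx_eval_row_poly map_mx_kbase -commute_companion_row_eval.
have CAt : mx_eval CA t = R.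
  by rewrite mx_eval_row_poly map_mx_kbase /R /elt Ca.
have Qt : mx_eval Q t = CB by rewrite mx_eval_conj // CAt -Cb.
have Rq : mx_eval R q = CA.
  have := CBq; rewrite /CB Cb mx_eval_conj // => /(congr1 (fun X => H * X * G)).
  by rewrite !mulrA HG !mul1r -!mulrA HG !mulr1.
have ps (c : 'rV[K]_n) : (1 < size (p_ c))%N by rewrite size_p_.
have QPq : p_ b %| p_ a \Po q.
  by apply: dvdp_companion; rewrite mx_eval_comp CBq mx_eval_p_ map_mx_kbase.
have PQt : p_ a %| p_ b \Po t.
  by apply: dvdp_companion; rewrite mx_eval_comp CAt mx_eval_p_ map_mx_kbase.
have Qtq : p_ b %| (t \Po q) - 'X.
  by apply: dvdp_companion; rewrite mx_evalB mx_eval_comp CBq Qt mx_evalX subrr.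
have Pqt : p_ a %| (q \Po t) - 'X.
  by apply: dvdp_companion; rewrite mx_evalB mx_eval_comp CAt Rq mx_evalX subrr.
split; first split.
- exact: (@separable_transfer K (p_ a) (p_ b) q t).
- exact: (@irreducible_transfer K (p_ a) (p_ b) q t).
have [f fE] := qpoly_subst_lrmorphism (ps a) (p_monic a) (ps b) (p_monic b) QPq.
exists f; exists (@qpoly_subst K (p_ b) (p_ a) t) => x; rewrite fE.
  exact: (qpoly_substK (ps a) (p_monic a) (ps b) (p_monic b) PQt Pqt).
exact: (qpoly_substK (ps b) (p_monic b) (ps a) (p_monic a) QPq Qtq).
Qed.

(** The generator is x itself: its matrix of powers is the identity and its relation is p_a. *)
Lemma base_point a :
  exists (r : 'rV[kbase K]_n) d, elt_det a r * d = 1 /\ elt_coefs a r d = a.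
Proof.
pose C := base_companion a (kbase K).
have eC : elt a (row 0 C) = C by apply: elt_row0.
have d1 : elt_det a (row 0 C) * 1 = 1.
  by rewrite /elt_det eC krylov_companion mulr1; apply: det1.
exists (row 0 C), 1; split=> //; apply/(elt_coefsP _ d1).
by rewrite eC /C /base_companion map_mx_kbase; apply: monic_eval_companion.
Qed.

End RationalPoints.

                                          

(** * Gluing along Zariski covers, and representable functors *)

Section Gluing.
Variables (K : fieldType) (A : kalg K) (m : nat) (f : 'I_m -> A).
Variables (B : 'I_m -> kalg K) (h : forall i, khom A (B i)).
Hypotheses (f1 : in_ideal f 1) (hloc : forall i, is_localization (h i) (f i)).

Lemma localizations_inj (y z : A) : (forall i, h i y = h i z) -> y = z.
Proof.
move=> E; apply/eqP; rewrite -subr_eq0; apply/eqP.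
apply: (annihilated_locally f1) => i; have [_ _ hker] := hloc i.
by apply: hker; rewrite rmorphB E subrr.
Qed.

Variables (B2 : 'I_m -> 'I_m -> kalg K) (h2 : forall i j, khom A (B2 i j)).
Variables (l : forall i j, khom (B i) (B2 i j)).
Variables (r : forall i j, khom (B j) (B2 i j)).
Hypothesis h2loc : forall i j, is_localization (h2 i j) (f i * f j).
Hypothesis lE : forall i j a, l i j (h i a) = h2 i j a.
Hypothesis rE : forall i j a, r i j (h j a) = h2 i j a.

Lemma glue_elements (x : forall i, B i) :
  (forall i j, l i j (x i) = r i j (x j)) -> exists y : A, forall i, h i y = x i.
Proof.
move=> lr.
have /fin_all_exists[a /fin_all_exists[k0 ak0]] :
    forall i, exists (a : A) k, x i * h i (f i) ^+ k = h i a.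
  by move=> i; have [_ hfrac _] := hloc i; apply: hfrac.
pose k := \max_i k0 i.
have [a' a'E] : exists a', forall i, x i * h i (f i) ^+ k = h i (a' i).
  exists (fun i => a i * f i ^+ (k - k0 i)) => i.
  rewrite rmorphM rmorphXn /= -ak0 -mulrA -exprD subnKC //.
  exact: leq_bigmax.
have /fin_all_exists[N0 N0P] : forall ij : 'I_m * 'I_m, exists N,
    (f ij.1 * f ij.2) ^+ N * (a' ij.1 * f ij.2 ^+ k - a' ij.2 * f ij.1 ^+ k) = 0.
  case=> i j /=; have [_ _ hker] := h2loc i j; apply: hker.
  rewrite rmorphB !rmorphM !rmorphXn /= -{1}(lE i j) -(rE i j (a' j)) -!a'E.
  rewrite !rmorphM !rmorphXn /= lr lE rE mulrAC.
  by rewrite subrr.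
pose N := \max_ij N0 ij.
(* Rewriting each x_i as c_i/f_i^e absorbs the powers of f_i f_j that annihilate the differences, so
   the numerators now satisfy c_i f_j^e = c_j f_i^e in A itself. *)
pose c i := a' i * f i ^+ N; pose e := (k + N)%N.
have cE i j : c i * f j ^+ e = c j * f i ^+ e.
  have E : (f i * f j) ^+ N * (a' i * f j ^+ k - a' j * f i ^+ k) = 0.
    have Nij : (N0 (i, j) <= N)%N by apply: leq_bigmax.
    by rewrite -(subnK Nij) exprD -mulrA (N0P (i, j)) mulr0.
  apply/eqP; rewrite -subr_eq0 -[X in _ == X]E; apply/eqP.
  rewrite mulrBr exprMn /c /e !exprD; congr (_ - _).
    by rewrite mulrACA mulrC.
  by rewrite mulrACA mulrC [f j ^+ N * _]mulrC.
(* Partition of unity: 1 is the sum of the g_j f_j^e, so y = sum of the g_j c_j satisfies y f_i^e =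
   c_i for every i. *)
have [g gE] := in_ideal_expr (fun=> e) f1.
exists (\sum_j g j * c j) => i.
have [[u fu] _ _] := hloc i.
have Ei : (\sum_j g j * c j) * f i ^+ e = c i.
  rewrite mulr_suml -[RHS]mulr1 gE mulr_sumr; apply: eq_bigr => j _.
  by rewrite -mulrA -cE mulrCA.
have : h i (\sum_j g j * c j) * h i (f i) ^+ e = x i * h i (f i) ^+ e.
  by rewrite -rmorphXn -rmorphM /= Ei /c rmorphM /= -a'E !rmorphXn /= /e exprD mulrA.
move=> /(congr1 (fun z => z * u ^+ e)).
by rewrite -!mulrA -exprMn fu expr1n !mulr1.
Qed.

Lemma glue_rows n (x : forall i, 'rV[B i]_n) :
    (forall i j, map_mx (l i j) (x i) = map_mx (r i j) (x j)) ->
  exists y : 'rV[A]_n, forall i, map_mx (h i) y = x i.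
Proof.
move=> lr.
have /fin_all_exists[y yE] : forall j, exists y, forall i, h i y = x i 0 j.
  move=> j; apply: glue_elements => i i'.
  by have /rowP/(_ j) := lr i i'; rewrite !mxE.
by exists (\row_j y j) => i; apply/rowP => j; rewrite !mxE yE.
Qed.

End Gluing.

Section Representable.
Variable K : fieldType.
Implicit Types (A B C : kalg K) (F : kfunctor K).

Definition represents F A (u : F A) :=
  (forall B (x : F B), exists h : khom A B, fmap h u = x) /\
  (forall B (h h' : khom A B), fmap h u = fmap h' u -> h =1 h').

Variables (F : kfunctor K) (A : kalg K) (u : F A).
Hypothesis rep : represents u.

Lemma represents_affine_open : affine_open u.
Proof.
split; first exact: rep.2.
move=> B x; exists (fun=> True) => C h; split=> _; last exact: rep.1.
exists 1%N, (fun=> 1); split=> //; exists (fun=> 1).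
by rewrite big_ord1 rmorph1 mulr1.
Qed.

Lemma represents_cover (I : Type) (i0 : I) :
  affine_open_cover (I := I) (A := fun=> A) (fun=> u).
Proof.
split=> [_|L _ x]; first exact: represents_affine_open.
by have [h hE] := rep.1 _ x; exists i0, h.
Qed.

Lemma represents_scheme : zariski_sheaf F -> is_scheme F.
Proof.
by move=> sh; split=> //; exists unit, (fun=> A), (fun=> u); apply: represents_cover.
Qed.

Lemma represents_finite_type : finite_type_hom (kinit A) -> finite_type F.
Proof.
move=> ft; exists 1%N, (fun=> A), (fun=> u); split=> //.
exact: represents_cover ord0.
Qed.

                                                                              
                                                     
(** An affine open Spec B of Spec A need not be principal, but it is covered by principal opens
    D(s_i) of Spec A. Over each one, the map from B to its localization at the image of s_i factors
    through the reduced ring A[1/s_i]. A nilpotent of B thus dies in every such localization, hence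
    is zero. *)
Lemma represents_reduced : is_reduced A -> reduced F.
Proof.
move=> redA B v [vmono vopen] x k xk.
have [phi phiE] := rep.1 _ v.
have [S SP] := vopen A u.
have [idB idBE] := khom_id B.
have [m [s [sS s1]]] : exists (m : nat) (s : 'I_m -> A),
    (forall i, S (s i)) /\ in_ideal (fun i => phi (s i)) 1.
  by apply/SP; exists idB; rewrite fmap_id.
apply: (annihilated_locally s1) => i.
have [L [hL locL]] := exists_localization (s i).
have [M [hM locM]] := exists_localization (phi (s i)).
have [psi psiE] : exists h : khom B L, fmap h v = fmap hL u.
  apply/SP; exists 1%N, (fun=> s i); split=> //.
  have [[g gE] _ _] := locL; exists (fun=> g).
  by rewrite big_ord1 mulrC gE.
have psiphi a : psi (phi a) = hL a.
  have [c cE] := khom_comp psi phi; rewrite -cE.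
  by apply: rep.2; rewrite (fmap_comp cE) phiE.
have [c cE] := khom_comp hM phi.
have [[e eE] _ hMker] := locM.
have [rho rhoE] : exists rho : khom L M, forall a, rho (hL a) = c a.
  by apply: (localization_lift (e := e) locL); rewrite cE.
have [d dE] := khom_comp rho psi.
(* The two maps out of B agree on the image of A; since Spec B is a subfunctor, that makes them
   equal. *)
have dM : d =1 hM.
  apply: vmono; rewrite -phiE.
  have [d' d'E] := khom_comp d phi; have [c' c'E] := khom_comp hM phi.
  rewrite -(fmap_comp d'E) -(fmap_comp c'E).
  have [i1 i1E] := khom_id M.
  rewrite -[RHS](fmap_id i1E); apply: fmap_comp => a.
  by rewrite i1E d'E dE psiphi rhoE cE c'E.
apply: hMker; rewrite -dM dE.
have redL := localization_reduced locL redA.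
have -> : psi x = 0 by apply: (redL _ k); rewrite -rmorphXn xk rmorph0.
by rewrite rmorph0.
Qed.

End Representable.

                                 

(** * The scheme of generators and its etale map to affine space *)

Section AffineSpaceRepresentable.
Variables (K : fieldType) (m : nat).

Definition coord_kalg : kalg K := mpoly_kalg (idfun : {rmorphism K -> K}) m.

Definition coord_row : 'rV[coord_kalg]_m := \row_j ('X_j : {mpoly K[m]}).

Lemma coord_kalg_lift (B : kalg K) (y : 'rV[B]_m) :
  exists h : khom coord_kalg B, map_mx h coord_row = y.
Proof.
have [[h [_ hX]] _] :=
  mpoly_is_polynomial_ring (kinit B : khom (KAlg idfun) B) (fun j => y 0 j).
by exists h; apply/rowP => j; rewrite !mxE hX.
Qed.

Lemma coord_kalg_uniq (B : kalg K) (h h' : khom coord_kalg B) :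
  map_mx h coord_row = map_mx h' coord_row -> h =1 h'.
Proof.
move=> E; have [_ uniq] := mpoly_is_polynomial_ring
  (kinit B : khom (KAlg idfun) B) (fun j => h ('X_j : {mpoly K[m]})).
apply: uniq => //; try by move=> c; apply: khom_str.
by move=> j; have /rowP/(_ j) := E; rewrite !mxE.
Qed.

Lemma affine_space_represents :
  represents (F := affine_space K m) (A := coord_kalg) coord_row.
Proof.
by split=> [B x|B h h']; [apply: coord_kalg_lift | apply: coord_kalg_uniq].
Qed.

End AffineSpaceRepresentable.

Section GeneratorScheme.
Variables (K : fieldType) (n' : nat) (a : 'rV[K]_n'.+1).
Local Notation n := n'.+1.
Implicit Types A B C : kalg K.

                                                                              
                                                                            
(** Recording the inverse determinant makes the principal open an affine functor. The equation is
    boolean, so its proofs are unique and a point is determined by its pair. *)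
Definition gen_pts A := {x : 'rV[A]_n * A | elt_det a x.1 * x.2 == 1}.

Fact gen_fmap_subproof A B (h : khom A B) (x : gen_pts A) :
  elt_det a (map_mx h (val x).1) * h (val x).2 == 1.
Proof.
by case: x => -[r d] /= /eqP E; rewrite -map_elt_det -rmorphM /= E rmorph1.
Qed.

Definition gen_fmap A B (h : khom A B) (x : gen_pts A) : gen_pts B :=
  exist _ (map_mx h (val x).1, h (val x).2) (gen_fmap_subproof h x).

Fact gen_fmap_id A (h : khom A A) :
  (forall c, h c = c) -> forall x, gen_fmap h x = x.
Proof.
move=> hE [[r d] rd]; apply: val_inj => /=; rewrite hE; congr (_, _).
exact: affine_fmap_id.
Qed.

Fact gen_fmap_comp A B C (g : khom B C) (h : khom A B) (k : khom A C) :
  (forall c, k c = g (h c)) -> forall x, gen_fmap k x = gen_fmap g (gen_fmap h x).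
Proof.
move=> kE x; apply: val_inj => /=; rewrite kE; congr (_, _).
exact: affine_fmap_comp.
Qed.

Definition gen_functor : kfunctor K := KFunctor gen_fmap_id gen_fmap_comp.

Lemma gen_pts_mul A (x : gen_functor A) : elt_det a (val x).1 * (val x).2 = 1.
Proof. by case: x => ? /= /eqP. Qed.

Lemma gen_pts_eq A (x y : gen_functor A) : (val x).1 = (val y).1 -> x = y.
Proof.
case: x y => -[r d] rd [[r' d'] rd'] /= E; rewrite -{r'}E in rd' *.
apply: val_inj; congr (_, _); move/eqP: rd => /= rd; move/eqP: rd' => /= rd'.
by rewrite -[d]mulr1 -rd' mulrCA mulrA rd mul1r.
Qed.

Definition gen_map_app A (x : gen_functor A) : affine_space K n A :=
  elt_coefs a (val x).1 (val x).2.

Fact gen_map_nat A B (h : khom A B) (x : gen_functor A) :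
  gen_map_app (fmap h x) = fmap h (gen_map_app x).
Proof. by rewrite /gen_map_app /= map_elt_coefs. Qed.

Definition gen_map : kmor gen_functor (affine_space K n) := KMor gen_map_nat.

Lemma gen_sheaf : zariski_sheaf gen_functor.
Proof.
move=> A m f B h B2 h2 l r f1 hloc h2loc lE rE x lr.
have [y1 y1E] : exists y : 'rV[A]_n, forall i, map_mx (h i) y = (val (x i)).1.
  apply: (glue_rows f1 hloc h2loc lE rE) => i j.
  by have := congr1 (fun z => (val z).1) (lr i j).
have [y2 y2E] : exists y : A, forall i, h i y = (val (x i)).2.
  apply: (glue_elements f1 hloc h2loc lE rE) => i j.
  by have := congr1 (fun z => (val z).2) (lr i j).
have y12 : elt_det a y1 * y2 == 1.
  apply/eqP/(localizations_inj f1 hloc) => i.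
  by rewrite rmorphM map_elt_det y1E y2E gen_pts_mul rmorph1.
exists (exist _ (y1, y2) y12); split=> [i|z zE].
  by apply: gen_pts_eq; rewrite /= y1E.
apply: gen_pts_eq => /=; apply/rowP => j; apply: (localizations_inj f1 hloc) => i.
have := congr1 (fun w => (val w).1) (zE i); rewrite -y1E => /rowP/(_ j).
by rewrite !mxE.
Qed.

Lemma gen_separated : separated gen_functor.
Proof.
move=> A x y; exists (fun s => exists j, s = (val x).1 0 j - (val y).1 0 j).
move=> B h; split=> [E _ [j ->]|E].
  have /rowP/(_ j) := congr1 (fun z => (val z).1) E.
  by rewrite /= !mxE rmorphB => ->; rewrite subrr.
apply: gen_pts_eq; apply/rowP => j; rewrite !mxE; apply/eqP.
by rewrite -subr_eq0 -rmorphB; apply/eqP/E; exists j.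
Qed.

Lemma gen_map_formally_etale : separable_poly (p_ a) -> formally_etale gen_map.
Proof.
move=> sepa A B h hsurj hsq x w E.
have [s [e [se hs sw]]] :=
  generator_lift hsurj hsq sepa (gen_pts_mul x) E.
have se' : elt_det a s * e == 1 by apply/eqP.
exists (exist _ (s, e) se'); split=> [|v [hv vw]].
  by split=> //; apply: gen_pts_eq.
apply: gen_pts_eq => /=.
apply: (generator_uniq hsq sepa se (gen_pts_mul v)); last by rewrite sw -vw.
by rewrite hs -hv.
Qed.

Section CoordinateRing.
Variables (O : kalg K) (hO : khom (coord_kalg K n) O) (u : gen_functor O).
Hypothesis locO : is_localization hO (elt_det a (coord_row K n)).
Hypothesis uE : (val u).1 = map_mx hO (coord_row K n).

(** A homomorphism out of the localized polynomial ring O amounts to a row whose determinant is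
    invertible; u is the universal such row. *)
Lemma gen_represents : represents u.
Proof.
split=> [B x|B h h' E].
  have [g gE] := coord_kalg_lift (val x).1.
  have [k kE] : exists k : khom O B, forall c, k (hO c) = g c.
    apply: (localization_lift (e := (val x).2) locO).
    by rewrite map_elt_det gE gen_pts_mul.
  exists k; apply: gen_pts_eq; rewrite /= uE -gE.
  by apply/rowP => j; rewrite !mxE kE.
apply: (localization_uniq locO).
have [k kE] := khom_comp h hO; have [k' k'E] := khom_comp h' hO.
suff kk' : k =1 k' by move=> c; rewrite -kE -k'E kk'.
apply: coord_kalg_uniq; have := congr1 (fun z => (val z).1) E.
rewrite /= uE => /rowP Ej; apply/rowP => j.
by have := Ej j; rewrite !mxE kE k'E.
Qed.

Lemma coord_kalg_reduced : is_reduced (coord_kalg K n).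
Proof.
move=> x k /eqP; rewrite (expf_eq0 (x : {mpoly K[n]})) => /andP[_ /eqP].
by [].
Qed.

Lemma gen_reduced : reduced gen_functor.
Proof.
apply: (represents_reduced gen_represents).
exact: localization_reduced locO coord_kalg_reduced.
Qed.

Definition gen_vars (i : 'I_(n + 1)) : O :=
  row_mx (val u).1 ((val u).2%:M : 'M_1) 0 i.

Lemma gen_vars_row j : gen_vars (lshift 1 j) = (val u).1 0 j.
Proof. by rewrite /gen_vars row_mxEl. Qed.

Lemma gen_vars_inv : gen_vars (rshift n 0) = (val u).2.
Proof. by rewrite /gen_vars row_mxEr mxE. Qed.

Lemma gen_vars_generate P (q : khom P O) (X : 'I_(n + 1) -> P) :
  (forall j, q (X j) = gen_vars j) -> surjective_hom q.
Proof.
move=> qX b.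
have [_ hfrac _] := locO; have [c [k E]] := hfrac b.
have [g gE] := coord_kalg_lift (\row_j X (lshift 1 j)).
have [qg qgE] := khom_comp q g.
have qgO : qg =1 hO.
  apply: coord_kalg_uniq; rewrite -uE; apply/rowP => j.
  have /rowP/(_ j) := gE; rewrite !mxE qgE => ->.
  by rewrite qX gen_vars_row.
exists (g c * X (rshift n 0) ^+ k).
rewrite rmorphM rmorphXn /= -qgE qgO -E qX gen_vars_inv -mulrA -exprMn.
by rewrite map_elt_det -uE gen_pts_mul expr1n mulr1.
Qed.

Lemma gen_finite_type : finite_type gen_functor.
Proof.
apply: (represents_finite_type gen_represents).
have pol := @mpoly_is_polynomial_ring K K idfun (n + 1).
set P := mpoly_kalg _ _ in pol; set i := mpoly_khom _ _ in pol.
set X := fun j => _ in pol.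
have [[q [qi qX]] _] := pol O (kinit O) gen_vars.
exists (n + 1)%N, P, i, X, q; split.
- exact: pol.
- exact: qi.
- exact: gen_vars_generate qX.
Qed.

                                                                         
                                                                             
                                          
(** Here O is an algebra over the coordinate ring of the target through the coefficient map [phi],
    not through [hO]. It is generated by r and d, subject to the n equations saying that r has
    relation b and to the equation that d inverts the determinant. *)
Lemma gen_finite_presentation (phi : khom (coord_kalg K n) O) :
  map_mx phi (coord_row K n) = gen_map O u -> finite_presentation_hom phi.
Proof.
move=> phiE.
pose D := coord_kalg K n.
have pol := @mpoly_is_polynomial_ring K {mpoly K[n]} (kalg_str D) (n + 1).
set P := mpoly_kalg _ _ in pol; set i := mpoly_khom _ _ in pol.
set X := fun j => _ in pol.
have [[q [qi qX]] _] := pol O phi gen_vars.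
exists (n + 1)%N, P, i, X, q; split=> //; first exact: gen_vars_generate qX.
pose r : 'rV[P]_n := \row_j X (lshift 1 j); pose d := X (rshift n 0).
have qr : map_mx q r = (val u).1.
  by apply/rowP => j; rewrite !mxE qX gen_vars_row.
have qd : q d = (val u).2 by rewrite qX gen_vars_inv.
pose b : 'rV[P]_n := map_mx i (coord_row K n).
pose rel (j : 'I_(n + 1)) : P :=
  row_mx (b - elt_coefs a r d) ((elt_det a r * d - 1)%:M : 'M_1) 0 j.
exists (n + 1)%N, rel => p; split; last first.
  have qrel j : q (rel j) = 0.
    rewrite /rel; case: (split_ordP j) => k ->; rewrite ?row_mxEl ?row_mxEr.
      suff /rowP/(_ k) : map_mx q (b - elt_coefs a r d) = 0 by rewrite !mxE.
      rewrite map_mxB map_elt_coefs qr qd -[elt_coefs _ _ _]phiE.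
      by apply/rowP => l; rewrite !mxE; apply/eqP; rewrite subr_eq0; apply/eqP/qi.
    rewrite mxE [k]ord1 eqxx mulr1n rmorphB rmorphM map_elt_det qr qd.
    by rewrite gen_pts_mul rmorph1 subrr.
  move=> [c ->]; rewrite rmorph_sum big1 // => j _.
  by rewrite rmorphM /= qrel mulr0.
(* To see that the relations generate the whole kernel of [q], divide P by them. The classes of r
   and d form a point of the functor over the quotient, so universality of O gives [chi], and [chi]
   after [q] is [pi]; hence the kernel of [q] lies in that of [pi]. *)
move=> qp; have [Q [pi [_ pi0]]] := exists_quotient (ideal_gen rel).
apply/pi0.
have pirel j : pi (rel j) = 0 by apply/pi0/in_ideal_gen.
have pird : elt_det a (map_mx pi r) * pi d == 1.
  rewrite -map_elt_det -rmorphM -subr_eq0 -(rmorph1 pi) -rmorphB.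
  by have := pirel (rshift n 0); rewrite /rel row_mxEr mxE mulr1n => ->.
pose v : gen_functor Q := exist _ (map_mx pi r, pi d) pird.
have [chi chiE] := gen_represents.1 _ v.
have chiu : map_mx chi (val u).1 = map_mx pi r.
  by have := congr1 (fun z => (val z).1) chiE.
have chid : chi (val u).2 = pi d.
  by have := congr1 (fun z => (val z).2) chiE.
have [chiq chiqE] := khom_comp chi q.
have [pii piiE] := khom_comp pi i.
have pib : map_mx pi b = map_mx pi (elt_coefs a r d).
  apply/eqP; rewrite -subr_eq0 -map_mxB; apply/eqP/rowP => j.
  by rewrite [LHS]mxE [RHS]mxE; have := pirel (lshift 1 j); rewrite /rel row_mxEl.
have chii c : chiq (i c) = pii c.
  have [chiphi chiphiE] := khom_comp chi phi.
  rewrite chiqE qi -chiphiE; move: c; apply: coord_kalg_uniq.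
  have -> : map_mx chiphi (coord_row K n) = map_mx chi (map_mx phi (coord_row K n)).
    by apply/rowP => j; rewrite !mxE chiphiE.
  have -> : map_mx pii (coord_row K n) = map_mx pi b.
    by apply/rowP => j; rewrite !mxE piiE.
  by rewrite phiE pib !map_elt_coefs chiu chid.
have [_ uniq] := pol Q pii (fun j => pi (X j)).
rewrite -(uniq chiq pi) //; first by rewrite chiqE qp rmorph0.
move=> j; rewrite chiqE qX; case: (split_ordP j) => k ->.
  by rewrite gen_vars_row; have /rowP/(_ k) := chiu; rewrite !mxE.
by rewrite [k]ord1 gen_vars_inv.
Qed.

End CoordinateRing.

Lemma gen_coordinate_ring :
  exists O (hO : khom (coord_kalg K n) O) (u : gen_functor O),
    is_localization hO (elt_det a (coord_row K n)) /\
    (val u).1 = map_mx hO (coord_row K n).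
Proof.
have [O [hO locO]] := exists_localization (elt_det a (coord_row K n)).
have [[g /eqP gE] _ _] := locO; rewrite map_elt_det in gE.
by exists O, hO, (exist _ (_, g) gE).
Qed.

Lemma gen_variety : is_variety gen_functor.
Proof.
have [O [hO [u [locO uE]]]] := gen_coordinate_ring.
split.
- exact: represents_scheme (gen_represents locO uE) gen_sheaf.
- exact: gen_separated.
- exact: gen_reduced locO uE.
- exact: gen_finite_type locO uE.
Qed.

(** Source and target are both affine, so one global chart serves at every point for finite
    presentation. *)
Lemma gen_map_etale : separable_poly (p_ a) -> etale gen_map.
Proof.
move=> sepa; split; last exact: gen_map_formally_etale.
have [O [hO [u [locO uE]]]] := gen_coordinate_ring.
have rep := gen_represents locO uE.
move=> L _ x; have [phi phiE] := coord_kalg_lift (gen_map O u).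
exists O, u, (coord_kalg K n), (coord_row K n), phi; split.
- exact: represents_affine_open.
- exact: rep.1.
- exact/represents_affine_open/affine_space_represents.
- exact/esym.
- exact: gen_finite_presentation locO uE _ phiE.
Qed.

End GeneratorScheme.

Theorem theorem4p3 (K : fieldType) (n : nat) (hn : (1 <= n)%N)
    (a : 'rV[K]_n) (ha : U a) :
  exists X : 'rV[K]_n -> Prop,
    [/\ @EE_subset K (affine_space K n) X,
        X a
      & forall b : 'rV[K]_n, X b -> U b /\ approx a b].
Proof.
case: n hn a ha => // n' _ a ha.
exists (fun b => exists v : gen_functor a (kbase K), gen_map a (kbase K) v = b).
split.
- exists (gen_functor a), (gen_map a); split=> //; first exact: gen_variety.
  exact: gen_map_etale ha.1.
- have [r [d [/eqP rd E]]] := base_point a.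
  by exists (exist _ (r, d) rd).
- by move=> _ [v <-]; apply: rational_point_approx ha (gen_pts_mul v).
Qed.
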